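(* Let $C:\{0,1\}^n\times\{0,1\}^t\to\{0,1\}$ be a $(k,\epsilon)$-strong extractor with an $s$-bit seed, and let $S_1,\dots,S_m\subset[d]$ be a weak $(t,r)$-design. Then Trevisan's extractor $\mathrm{Ext}_C:\{0,1\}^n\times\{0,1\}^d\to\{0,1\}^m$ is a quantum-proof $(k+rm+\log(1/\epsilon),\,6m\sqrt{\epsilon})$-strong extractor with an $s'$-bit seed, where $s'=d-\big(t-s-\log\frac{1}{3\sqrt{\epsilon}}\big)$.
   Context: Logarithms base 2; $x_S$ denotes the bits of $x$ at positions in $S$; $\|A\|_{\mathrm{tr}}=\mathrm{tr}\sqrt{A^\dagger A}$; $\rho_{U_m}=2^{-m}\mathbb{1}$. Conditional min-entropy: $H_{\min}(A|B)_\rho=\max_{\sigma_B}\sup\{\lambda:2^{-\lambda}\mathbb{1}_A\otimes\sigma_B\ge\rho_{AB}\}$ over density operators $\sigma_B$; for trivial $B$ it is $-\log\max_xP_X(x)$. A function $\mathrm{Ext}:\{0,1\}^n\times\{0,1\}^d\to\{0,1\}^m$ is a $(k,\epsilon)$-strong extractor with an $s$-bit seed if for every random variable $X$ with $H_{\min}(X)\ge k$ and every random variable $Y$ on $\{0,1\}^d$ independent of $X$ with $H_{\min}(Y)\ge s$, $\frac12\|\rho_{\mathrm{Ext}(X,Y)Y}-\rho_{U_m}\otimes\rho_Y\|_{\mathrm{tr}}\le\epsilon$. It is a quantum-proof $(k,\epsilon)$-strong extractor with an $s$-bit seed if for every state $\rho_{XE}$ classical on $X$ with $H_{\min}(X|E)\ge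 k$ and every $Y$ independent of $XE$ with $H_{\min}(Y)\ge s$, $\frac12\|\rho_{\mathrm{Ext}(X,Y)YE}-\rho_{U_m}\otimes\rho_Y\otimes\rho_E\|_{\mathrm{tr}}\le\epsilon$. Weak $(t,r)$-design: sets $S_1,\dots,S_m\subset[d]$ with $|S_i|=t$ and $\sum_{j=1}^{i-1}2^{|S_j\cap S_i|}\le rm$ for all $i$. Trevisan's extractor: $\mathrm{Ext}_C(x,y)=C(x,y_{S_1})\cdots C(x,y_{S_m})$. *)

(* Defs.v *)
From Stdlib Require Import Reals ClassicalEpsilon.
From mathcomp Require Import all_boot.

Set Implicit Arguments.
Unset Strict Implicit.
Unset Printing Implicit Defensive.

Local Open Scope R_scope.

Record cplx := Cx { re : R; im : R }.
Definition C0 : cplx := Cx 0 0.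
Definition C1 : cplx := Cx 1 0.
Definition CofR (x : R) : cplx := Cx x 0.
Definition Cadd (a b : cplx) : cplx := Cx (re a + re b) (im a + im b).
Definition Copp (a : cplx) : cplx := Cx (- re a) (- im a).
Definition Cmul (a b : cplx) : cplx :=
  Cx (re a * re b - im a * im b) (re a * im b + im a * re b).
Definition Cconj (a : cplx) : cplx := Cx (re a) (- im a).

Definition Csum (T : finType) (F : T -> cplx) : cplx := \big[Cadd/C0]_(i : T) F i.
Definition Rsum (T : finType) (F : T -> R) : R := \big[Rplus/0]_(i : T) F i.

Definition mx (T : finType) := T -> T -> cplx.

Definition mmul (T : finType) (A B : mx T) : mx T :=
  fun i j => Csum (fun l => Cmul (A i l) (B l j)).
Definition madj (T : finType) (A : mx T) : mx T := fun i j => Cconj (A j i).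
Definition madd (T : finType) (A B : mx T) : mx T := fun i j => Cadd (A i j) (B i j).
Definition msub (T : finType) (A B : mx T) : mx T := fun i j => Cadd (A i j) (Copp (B i j)).
Definition mscale (T : finType) (c : R) (A : mx T) : mx T := fun i j => Cmul (CofR c) (A i j).
Definition msum (I T : finType) (F : I -> mx T) : mx T := fun i j => Csum (fun x => F x i j).
Definition mtr (T : finType) (A : mx T) : cplx := Csum (fun i => A i i).
Definition mid (T : finType) : mx T := fun i j => if i == j then C1 else C0.
Definition proj (T : finType) (z : T) : mx T :=
  fun i j => if (i == z) && (j == z) then C1 else C0.
Definition diagmx (T : finType) (P : T -> R) : mx T :=
  fun i j => if i == j then CofR (P i) else C0.
Definition mtensor (T1 T2 : finType) (A : mx T1) (B : mx T2) : mx (T1 * T2)%type :=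
  fun p q => Cmul (A p.1 q.1) (B p.2 q.2).
Definition ptrace1 (T1 T2 : finType) (rho : mx (T1 * T2)%type) : mx T2 :=
  fun e e' => Csum (fun x => rho (x, e) (x, e')).
Definition block (T1 T2 : finType) (rho : mx (T1 * T2)%type) (x : T1) : mx T2 :=
  fun e e' => rho (x, e) (x, e').

Definition qform (T : finType) (A : mx T) (v : T -> cplx) : cplx :=
  Csum (fun i => Csum (fun j => Cmul (Cmul (Cconj (v i)) (A i j)) (v j))).
Definition psd (T : finType) (A : mx T) : Prop :=
  forall v : T -> cplx, 0 <= re (qform A v) /\ im (qform A v) = 0.
Definition density (T : finType) (A : mx T) : Prop := psd A /\ mtr A = C1.

(* the (unique) positive semidefinite square root *)
Definition msqrt (T : finType) (A : mx T) : mx T :=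
  epsilon (inhabits (fun _ _ => C0 : cplx))
          (fun B : mx T => psd B /\ mmul B B = A).
Definition trnorm (T : finType) (A : mx T) : R := re (mtr (msqrt (mmul (madj A) A))).

Definition log2 (x : R) : R := ln x / ln 2.

Definition is_distr (T : finType) (P : T -> R) : Prop :=
  (forall x, 0 <= P x) /\ Rsum P = 1.

Definition Hmin_cl (T : finType) (P : T -> R) : R := - log2 (\big[Rmax/0]_(x : T) P x).

Definition Hmin_q (A B : finType) (rho : mx (A * B)%type) : R :=
  epsilon (inhabits 0)
    (is_lub (fun lam => exists sigma : mx B, density sigma /\
        psd (msub (mscale (Rpower 2 (- lam)) (mtensor (@mid A) sigma)) rho))).

Definition bits (n : nat) := (n.-tuple bool).

Definition rhoU (m : nat) : mx (bits m) := mscale (/ pow 2 m) (@mid (bits m)).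

Definition cl_ext_state (n d m : nat) (Ext : bits n -> bits d -> bits m)
    (PX : bits n -> R) (PY : bits d -> R) : mx (bits m * bits d)%type :=
  msum (fun x => msum (fun y =>
     mscale (PX x * PY y) (mtensor (proj (Ext x y)) (proj y)))).

Definition strong_ext (n d m : nat) (Ext : bits n -> bits d -> bits m) (k eps s : R) : Prop :=
  forall (PX : bits n -> R) (PY : bits d -> R),
    is_distr PX -> is_distr PY -> k <= Hmin_cl PX -> s <= Hmin_cl PY ->
    / 2 * trnorm (msub (cl_ext_state Ext PX PY) (mtensor (@rhoU m) (diagmx PY))) <= eps.

Definition classical_on_X (X E : finType) (rho : mx (X * E)%type) : Prop :=
  forall x x' e e', x != x' -> rho (x, e) (x', e') = C0.

(* rho_{Ext(X,Y) Y E} for rho_XE = sum_x |x><x| (x) rho_E^x and Y ~ PY independent *)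
Definition ext_state (n d m : nat) (E : finType) (Ext : bits n -> bits d -> bits m)
    (PY : bits d -> R) (rho : mx (bits n * E)%type) : mx ((bits m * bits d) * E)%type :=
  msum (fun x => msum (fun y =>
     mscale (PY y) (mtensor (mtensor (proj (Ext x y)) (proj y)) (block rho x)))).

Definition qproof_strong_ext (n d m : nat) (Ext : bits n -> bits d -> bits m)
    (k eps s : R) : Prop :=
  forall (E : finType) (rho : mx (bits n * E)%type) (PY : bits d -> R),
    density rho -> classical_on_X rho -> is_distr PY ->
    k <= Hmin_q rho -> s <= Hmin_cl PY ->
    / 2 * trnorm (msub (ext_state Ext PY rho)
                       (mtensor (mtensor (@rhoU m) (diagmx PY)) (ptrace1 rho))) <= eps.

Definition weak_design (d t m : nat) (r : R) (S : 'I_m -> {set 'I_d}) : Prop :=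
  (forall i, #|S i| = t) /\
  (forall i : 'I_m,
     \big[Rplus/0]_(j : 'I_m | (j < i)%N) pow 2 #|S j :&: S i| <= r * INR m).

Definition restr (d t : nat) (y : bits d) (S : {set 'I_d}) : bits t :=
  [tuple nth false y (nth 0%N (map val (enum S)) j) | j < t].

Definition trevisan (n t d m : nat) (C : bits n -> bits t -> bool)
    (S : 'I_m -> {set 'I_d}) (x : bits n) (y : bits d) : bits m :=
  [tuple C x (@restr d t y (S i)) | i < m].

Definition one_bit (n t : nat) (C : bits n -> bits t -> bool) : bits n -> bits t -> bits 1 :=
  fun x y => [tuple C x y].

(* Main.v *)
Require Import Defs.
From Stdlib Require Import Reals ClassicalEpsilon FunctionalExtensionality.
From mathcomp Require Import all_boot all_order all_algebra.
From mathcomp Require Import ring lra zify complex Rstruct.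

(* The distance of the output from uniform is telescoped over the output bits.
   For the [i]-th bit, fix the seed bits [w] outside [S_i]: the earlier bits
   then depend on [x] and on the remaining seed [v] only through a table of at
   most [r m] bits computed from [x], which may be handed to the adversary as
   advice at the price of [r m] bits of min-entropy.  For one output bit, the
   pretty good measurement [F_x' = rho^(-1/2) rho_x' rho^(-1/2)], which does not
   depend on [v], satisfies for all signs [f] and all [c > 0]
     [2 ||sum_x f_x rho_x||_1 <= c tr rho + 1/c sum_(x,x') f_x f_x' tr(rho_x F_x')],
   so the quantum adversary is replaced by the classical outcome [x'].  The
   outcomes given which [X] has min-entropy below [k] have total probability at
   most [2 eps], and for the others the classical extractor property applies;
   [c = sqrt eps] then gives [3 sqrt eps].  The fixings [w] given which the seed
   has min-entropy below [s] have total probability at most [3 sqrt eps]. *)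

Set Implicit Arguments.
Unset Strict Implicit.
Unset Printing Implicit Defensive.

Import Order.TTheory GRing.Theory Num.Theory.
Local Open Scope ring_scope.
Local Open Scope sesquilinear_scope.
Delimit Scope R_scope with coqR.

(** * Positive semidefinite matrices *)

Section PsdMatrices.
Variable C : numClosedFieldType.

Definition psdm n (A : 'M[C]_n) := forall v : 'rV[C]_n, 0 <= (v *m A *m v^t*) 0 0.

Lemma mulmx_adj m n p (A : 'M[C]_(m, n)) (B : 'M[C]_(n, p)) :
  (A *m B)^t* = B^t* *m A^t*.
Proof. by rewrite trmx_mul map_mxM. Qed.

Lemma adjmxD m n (A B : 'M[C]_(m, n)) : (A + B)^t* = A^t* + B^t*.
Proof. by apply/matrixP => i j; rewrite !mxE rmorphD. Qed.

Lemma adjmxZ m n a (A : 'M[C]_(m, n)) : (a *: A)^t* = a^* *: A^t*.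
Proof. by apply/matrixP => i j; rewrite !mxE rmorphM. Qed.

Lemma qformE n (A : 'M[C]_n) (v : 'rV[C]_n) :
  (v *m A *m v^t*) 0 0 = \sum_i \sum_j v 0 i * A i j * (v 0 j)^*.
Proof.
rewrite mxE exchange_big /=; apply: eq_bigr => j _.
by rewrite !mxE mulr_suml.
Qed.

Lemma psdmD n (A B : 'M[C]_n) : psdm A -> psdm B -> psdm (A + B).
Proof. by move=> hA hB v; rewrite mulmxDr mulmxDl mxE addr_ge0. Qed.

Lemma psdm0 n : psdm (0 : 'M[C]_n).
Proof. by move=> v; rewrite mulmx0 mul0mx mxE. Qed.

Lemma psdm_sum n (I : Type) (r : seq I) (P : pred I) (F : I -> 'M[C]_n) :
  (forall i, P i -> psdm (F i)) -> psdm (\sum_(i <- r | P i) F i).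
Proof.
by move=> h; elim/big_ind : _ => //; [exact: psdm0 | exact: psdmD].
Qed.

Lemma psdmZ n a (A : 'M[C]_n) : 0 <= a -> psdm A -> psdm (a *: A).
Proof. by move=> a0 hA v; rewrite -scalemxAr -scalemxAl mxE mulr_ge0. Qed.

Lemma psdm_conj m n (A : 'M[C]_n) (B : 'M[C]_(n, m)) : psdm A -> psdm (B^t* *m A *m B).
Proof.
move=> hA v; have := hA (v *m B^t*).
by rewrite mulmx_adj trmxCK !mulmxA.
Qed.

Lemma psdm_diag n (D : 'rV[C]_n) : (forall i, 0 <= D 0 i) -> psdm (diag_mx D).
Proof.
move=> hD v; rewrite mul_mx_diag mxE sumr_ge0 // => i _.
by rewrite !mxE mulrAC mulr_ge0 // mul_conjC_ge0.
Qed.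

Lemma qform_delta n (A : 'M[C]_n) i j :
  ((delta_mx 0 i : 'rV[C]_n) *m A *m (delta_mx 0 j : 'rV[C]_n)^t*) 0 0 = A i j.
Proof. by rewrite -rowE trmx_delta map_delta_mx -colE !mxE. Qed.

Lemma psdm_entry n (A : 'M[C]_n) i : psdm A -> 0 <= A i i.
Proof. by move=> /(_ (delta_mx 0 i)); rewrite qform_delta. Qed.

Lemma psdm_tr_ge0 n (A : 'M[C]_n) : psdm A -> 0 <= \tr A.
Proof. by move=> hA; rewrite sumr_ge0 // => i _; apply: psdm_entry. Qed.

(** Polarisation: on combinations of two basis vectors the cross terms of the form must be real. The
    coefficients [(1, 1)] and [('i, 1)] give two equations that force [A j i] to be the conjugate of
    [A i j]. *)
Lemma psdm_herm n (A : 'M[C]_n) : psdm A -> A^t* = A.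
Proof.
move=> hA; apply/matrixP => i j; rewrite !mxE.
have sesq a b : a * A i j * b^* + b * A j i * a^* \is Num.real.
  have := hA (a *: delta_mx 0 i + b *: delta_mx 0 j).
  rewrite adjmxD !mulmxDl !mulmxDr mxE [X in 0 <= X + _]mxE [X in 0 <= _ + X]mxE.
  have E x y (k l : 'I_n) :
    ((x *: delta_mx 0 k : 'rV_n) *m A *m (y *: delta_mx 0 l : 'rV_n)^t*) 0 0 = x * A k l * y^*.
    rewrite adjmxZ -scalemxAr -!scalemxAl scalerA mxE qform_delta.
    by ring.
  rewrite !E => h.
  have r x k : x * A k k * x^* \is Num.real.
    by rewrite mulrAC ger0_real // mulr_ge0 ?mul_conjC_ge0 ?psdm_entry.
  have -> : a * A i j * b^* + b * A j i * a^* =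
      (a * A i i * a^* + a * A i j * b^* + (b * A j i * a^* + b * A j j * b^*))
      - (a * A i i * a^* + b * A j j * b^*).
    by ring.
  by apply: realB; [exact: ger0_real h | apply: realD; exact: r].
have := sesq 1 1; rewrite conjC1 !mulr1 !mul1r => h1.
have := sesq 'i 1; rewrite conjC1 !mulr1 !mul1r conjCi => h2.
move/CrealP: h1; rewrite rmorphD => h1.
move/CrealP: h2; rewrite rmorphD !rmorphM rmorphN /= conjCi => h2.
have {}h2 : - (A i j)^* + (A j i)^* = A i j - A j i.
  apply: (mulfI (neq0Ci C)).
  by transitivity (- 'i * (A i j)^* + (A j i)^* * - - 'i); [ring | rewrite h2; ring].
have {}h1 : (A i j)^* + (A j i)^* = A i j + A j i by [].
have : (A j i)^* *+ 2 = A i j *+ 2.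
  transitivity (((A i j)^* + (A j i)^*) + (- (A i j)^* + (A j i)^*)); first by ring.
  by rewrite h1 h2; ring.
by move/eqP; rewrite eqrMn2r //= => /eqP.
Qed.

Lemma spectral_herm n (A : 'M[C]_n) : A^t* = A ->
  let D := spectral_diag A in let U := spectralmx A in
  [/\ U \is unitarymx, forall i, D 0 i \is Num.real & A = U^t* *m diag_mx D *m U].
Proof.
move=> hA /=.
have hA' : A \is hermsymmx by apply/is_hermitianmxP; rewrite expr0 scale1r hA.
split; first exact: spectral_unitarymx.
  by move=> i; have /mxOverP := hermitian_spectral_diag_real hA'; apply.
have /orthomx_spectralP := hermitian_normalmx hA'.
by rewrite invmx_unitary ?spectral_unitarymx.
Qed.

Lemma unitary_adjM n (U : 'M[C]_n) : U \is unitarymx -> U^t* *m U = 1%:M.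
Proof. by rewrite -trmxC_unitary => /unitarymxP; rewrite trmxCK. Qed.

Lemma psdm_spectral_diag_ge0 n (A : 'M[C]_n) i : psdm A -> 0 <= spectral_diag A 0 i.
Proof.
move=> hA; have [uU _ eA] := spectral_herm (psdm_herm hA).
set U := spectralmx A in uU eA; set D := spectral_diag A in eA *.
have := psdm_entry i (psdm_conj (U^t*) hA).
rewrite trmxCK {1}eA !mulmxA (unitarymxP uU) mul1mx -mulmxA (unitarymxP uU) mulmx1.
by rewrite mxE eqxx.
Qed.

Lemma psdm_diag_adj n (D : 'rV[C]_n) (U : 'M[C]_n) :
  (forall i, 0 <= D 0 i) -> psdm (U^t* *m diag_mx D *m U).
Proof. by move=> hD; apply: psdm_conj; apply: psdm_diag. Qed.

Lemma mxtrace_unitary n (U A : 'M[C]_n) : U \is unitarymx ->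
  \tr (U^t* *m A *m U) = \tr A.
Proof. by move=> uU; rewrite mxtrace_mulC mulmxA (unitarymxP uU) mul1mx. Qed.

(** In an eigenbasis of [B] the trace is a sum of eigenvalues of [B] times diagonal entries of the
    rotated [A], all nonnegative. This makes measurement probabilities nonnegative and monotone in
    the state. *)
Lemma psdm_trM_ge0 n (A B : 'M[C]_n) : psdm A -> psdm B -> 0 <= \tr (A *m B).
Proof.
move=> hA hB; have [uU _ eB] := spectral_herm (psdm_herm hB).
set U := spectralmx B in uU eB; set D := spectral_diag B in eB.
rewrite eB !mulmxA mxtrace_mulC !mulmxA mul_mx_diag.
rewrite sumr_ge0 // => i _; rewrite mxE mulr_ge0 ?psdm_spectral_diag_ge0 //.
by apply: psdm_entry; have := psdm_conj (U^t*) hA; rewrite trmxCK.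
Qed.

(** * The trace norm of Hermitian matrices *)

(** This is the trace norm only for Hermitian [A], where [spectral_diag] lists the eigenvalues;
    [trnorm_tn] makes the link with the trace norm of the statement. *)
Definition tnorm n (A : 'M[C]_n) : C := \sum_i `|spectral_diag A 0 i|.

Lemma tnorm_ge0 n (A : 'M[C]_n) : 0 <= tnorm A.
Proof. by rewrite sumr_ge0. Qed.

Definition absm n (A : 'M[C]_n) : 'M[C]_n :=
  (spectralmx A)^t* *m diag_mx (map_mx Num.norm (spectral_diag A)) *m spectralmx A.

Lemma absm_psdm n (A : 'M[C]_n) : psdm (absm A).
Proof. by apply: psdm_diag_adj => i; rewrite mxE. Qed.

Lemma tr_absm n (A : 'M[C]_n) : \tr (absm A) = tnorm A.
Proof.
by rewrite mxtrace_unitary ?spectral_unitarymx // mxtrace_diag; apply: eq_bigr => i _; rewrite mxE.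
Qed.

Lemma absm_sqr n (A : 'M[C]_n) : A^t* = A -> absm A *m absm A = A *m A.
Proof.
move=> hA; have [uU rD eA] := spectral_herm hA.
rewrite {3 4}eA /absm; set U := spectralmx A in uU *; set D := spectral_diag A in rD *.
have E (X Y : 'M[C]_n) : U^t* *m X *m U *m (U^t* *m Y *m U) = U^t* *m (X *m Y) *m U.
  by rewrite !mulmxA -[_ *m U *m U^t*]mulmxA (unitarymxP uU) mulmx1.
rewrite !E !mulmx_diag; congr (_ *m diag_mx _ *m _).
by apply/rowP => i; rewrite !mxE -expr2 real_normK.
Qed.

Lemma absm_subl n (A : 'M[C]_n) : A^t* = A -> psdm (absm A - A).
Proof.
move=> hA; have [uU rD eA] := spectral_herm hA.
rewrite {2}eA /absm -mulmxBl -mulmxBr -linearB /=; apply: psdm_diag_adj => i.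
by rewrite !mxE subr_ge0 real_ler_norm.
Qed.

Lemma absm_addl n (A : 'M[C]_n) : A^t* = A -> psdm (absm A + A).
Proof.
move=> hA; have [uU rD eA] := spectral_herm hA.
rewrite {2}eA /absm -mulmxDl -mulmxDr -linearD /=; apply: psdm_diag_adj => i.
by rewrite !mxE -[X in _ + X]opprK subr_ge0 -normrN real_ler_norm // rpredN.
Qed.

(** In an eigenbasis of [A], each diagonal entry of [P] dominates both signs of the corresponding
    eigenvalue. Every later upper bound by domination goes through such a [P], which need not
    commute with [A]. *)
Lemma tnorm_le n (A P : 'M[C]_n) : A^t* = A -> psdm (P - A) -> psdm (P + A) ->
  tnorm A <= \tr P.
Proof.
move=> hA hm hp; have [uU rD eA] := spectral_herm hA.
set U := spectralmx A in uU eA; set D := spectral_diag A in rD eA.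
rewrite -(mxtrace_unitary P (U := U^t*)) ?trmxC_unitary // trmxCK.
apply: ler_sum => i _.
have eD : (U *m A *m U^t*) i i = D 0 i.
  by rewrite {1}eA !mulmxA (unitarymxP uU) mul1mx -mulmxA (unitarymxP uU) mulmx1 mxE eqxx.
have {}hm := psdm_entry i (psdm_conj (U^t*) hm).
have {}hp := psdm_entry i (psdm_conj (U^t*) hp).
move: hm hp; rewrite trmxCK mulmxBr mulmxBl mulmxDr mulmxDl mxE [X in _ + X]mxE eD [X in _ -> 0 <= X -> _]mxE eD => hm hp.
rewrite real_ler_norml //; apply/andP; split; rewrite -subr_ge0 //.
by rewrite opprK addrC.
Qed.

Lemma tnorm_psdm n (A : 'M[C]_n) : psdm A -> tnorm A <= \tr A.
Proof.
move=> hA; apply: tnorm_le (psdm_herm hA) _ _; first by rewrite subrr; apply: psdm0.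
exact: psdmD.
Qed.

(* Sandwiching [S *m S = B *m B] between the two eigenbases gives
   [s_i ^ 2 * w_ij = w_ij * b_j ^ 2], hence [s_i * w_ij = w_ij * b_j]. *)
Lemma psdm_sqrt_uniq n (S B : 'M[C]_n) : psdm S -> psdm B -> S *m S = B *m B -> S = B.
Proof.
move=> hS hB e.
have [uU _ eS] := spectral_herm (psdm_herm hS).
have [uV _ eB] := spectral_herm (psdm_herm hB).
have sge i := psdm_spectral_diag_ge0 i hS; have bge i := psdm_spectral_diag_ge0 i hB.
set U := spectralmx S in uU eS; set s := spectral_diag S in sge eS.
set V := spectralmx B in uV eB; set b := spectral_diag B in bge eB.
pose W := U *m V^t*.
have US : U *m S = diag_mx s *m U by rewrite {1}eS !mulmxA (unitarymxP uU) mul1mx.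
have BV : B *m V^t* = V^t* *m diag_mx b.
  by rewrite {1}eB -!mulmxA (unitarymxP uV) mulmx1.
have e2 : diag_mx s *m (diag_mx s *m W) = W *m diag_mx b *m diag_mx b.
  transitivity (U *m (S *m S) *m V^t*).
    by rewrite /W [_ *m (U *m _)]mulmxA -US -[U *m S *m _]mulmxA [LHS]mulmxA -US !mulmxA.
  by rewrite e /W -!mulmxA [V^t* *m (_ *m _)]mulmxA -BV -[B *m _ *m _]mulmxA -BV !mulmxA.
have e1 : diag_mx s *m W = W *m diag_mx b.
  move: e2; generalize W => X e2; apply/matrixP => i j; move/matrixP/(_ i j): e2.
  rewrite !mul_diag_mx !mul_mx_diag !mxE => h.
  have [->|x0] := eqVneq (X i j) 0; first by rewrite mulr0 mul0r.
  rewrite mulrC; congr (_ * _); apply/eqP.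
  rewrite -(@eqrXn2 _ 2) //; apply/eqP; apply: (mulfI x0).
  by transitivity (s 0 i * (s 0 i * X i j)); [ring | rewrite h; ring].
have : U^t* *m (diag_mx s *m W) *m V = U^t* *m (W *m diag_mx b) *m V by rewrite e1.
rewrite /W !mulmxA (unitary_adjM uU) mul1mx -eB.
by rewrite -[X in X = _]mulmxA (unitary_adjM uV) mulmx1 -eS.
Qed.

(** * Weighted bounds on the trace norm and the pretty good measurement *)

Lemma mul_le_weighted_sqr (t x y : C) : 0 < t -> 0 <= x -> 0 <= y ->
  x * y <= 2^-1 * (t * x ^+ 2 + t^-1 * y ^+ 2).
Proof.
move=> t0 x0 y0; rewrite -subr_ge0.
have -> : 2^-1 * (t * x ^+ 2 + t^-1 * y ^+ 2) - x * y = 2^-1 * t^-1 * (t * x - y) ^+ 2.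
  by field; rewrite gt_eqF.
apply: mulr_ge0; first by rewrite mulr_ge0 ?invr_ge0 ?ler0n ?(ltW t0).
apply: real_exprn_even_ge0 => //.
by rewrite realB ?realM ?ger0_real // ltW.
Qed.

Definition conjd n (V : 'M[C]_n) (D : 'rV[C]_n) := V^t* *m diag_mx D *m V.

Lemma conjdM n (V : 'M[C]_n) D E : V \is unitarymx ->
  conjd V D *m conjd V E = conjd V (\row_i (D 0 i * E 0 i)).
Proof.
move=> uV; rewrite /conjd !mulmxA -[_ *m V *m V^t*]mulmxA (unitarymxP uV) mulmx1.
by rewrite -[_ *m diag_mx D *m _]mulmxA mulmx_diag.
Qed.

Lemma conjd1 n (V : 'M[C]_n) : V \is unitarymx -> conjd V (const_mx 1) = 1%:M.
Proof. by move=> uV; rewrite /conjd diag_const_mx mulmx1 unitary_adjM. Qed.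

Lemma conjd_adj n (V : 'M[C]_n) (D : 'rV[C]_n) : (forall i, D 0 i \is Num.real) ->
  (conjd V D)^t* = conjd V D.
Proof.
move=> rD; rewrite /conjd !mulmx_adj trmxCK mulmxA; congr (_ *m _ *m _).
apply/matrixP => i j; rewrite !mxE [j == i]eq_sym; case: (eqVneq i j) => [->|_].
  by rewrite !mulr1n conj_Creal.
by rewrite !mulr0n conjC0.
Qed.

(** A weighted Cauchy-Schwarz inequality for [\tr (Z *m A)], where [Z] is the sign of [A], carried
    out entry by entry in the basis given by [V]. In the application [a] holds the square roots of
    the eigenvalues of a state, so that [R] is its inverse square root. *)
Lemma tnorm_weighted n (A V : 'M[C]_n) (a : 'rV[C]_n) (c : C) :
  A^t* = A -> V \is unitarymx -> (forall i, 0 < a 0 i) -> 0 < c ->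
  let R := conjd V (\row_i (a 0 i)^-1) in
  tnorm A <= 2^-1 * (c * (\sum_i a 0 i ^+ 2) + c^-1 * \tr (A *m R *m (A *m R))).
Proof.
move=> hA uV a0 c0 /=; set R := conjd V _.
have [uU rD eA] := spectral_herm hA.
set U := spectralmx A in uU eA; set D := spectral_diag A in rD eA.
(* The sign of a zero eigenvalue is taken to be 1, so that [Z] squares to the identity even when [A]
   is singular. *)
pose sg (i : 'I_n) : C := if 0 <= D 0 i then 1 else -1.
pose Z := conjd U (\row_i sg i).
have hZ : Z^t* = Z.
  by apply: conjd_adj => i; rewrite mxE /sg; case: ifP => _; rewrite ?rpredN real1.
have ZZ : Z *m Z = 1%:M.
  rewrite conjdM // -(conjd1 uU); congr conjd; apply/rowP => i; rewrite !mxE /sg.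
  by case: ifP => _; rewrite ?mulrNN mulr1.
have eZA : Z *m A = conjd U (\row_i (sg i * D 0 i)).
  by rewrite {1}eA -/(conjd U D) conjdM //; congr conjd; apply/rowP => i; rewrite !mxE.
have eZ : tnorm A = \tr (Z *m A).
  rewrite eZA mxtrace_unitary // mxtrace_diag.
  apply: eq_bigr => i _; rewrite !mxE /sg -/D; case: ifP => h; first by rewrite mul1r ger0_norm.
  by rewrite mulN1r ltr0_norm // real_ltNge ?rD ?real0 // h.
pose Z' := V *m Z *m V^t*; pose A' := V *m A *m V^t*.
have hermV (M : 'M[C]_n) : M^t* = M -> (V *m M *m V^t*)^t* = V *m M *m V^t*.
  by move=> hM; rewrite !mulmx_adj trmxCK hM mulmxA.
have mulV (M N : 'M[C]_n) : V *m M *m V^t* *m (V *m N *m V^t*) = V *m (M *m N) *m V^t*.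
  by rewrite !mulmxA -[_ *m V^t* *m V]mulmxA (unitary_adjM uV) mulmx1.
have hZ' : Z'^t* = Z' by apply: hermV.
have hA' : A'^t* = A' by apply: hermV.
have symA i j : `|A' j i| = `|A' i j| by rewrite -{1}hA' !mxE norm_conjC.
have symZ i j : `|Z' j i| = `|Z' i j| by rewrite -{1}hZ' !mxE norm_conjC.
have eZ' : \tr (Z *m A) = \sum_i \sum_j Z' i j * A' j i.
  have -> : \tr (Z *m A) = \tr (Z' *m A').
    by rewrite mulV -{1}(mxtrace_unitary (Z *m A) (U := V^t*)) ?trmxC_unitary // trmxCK.
  by apply: eq_bigr => i _; rewrite mxE.
have eR : \tr (A *m R *m (A *m R)) =
    \sum_i \sum_j (a 0 i * a 0 j)^-1 * `|A' i j| ^+ 2.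
  have -> : \tr (A *m R *m (A *m R)) =
      \tr (A' *m diag_mx (\row_i (a 0 i)^-1) *m (A' *m diag_mx (\row_i (a 0 i)^-1))).
    have <- : V *m (A *m R) *m V^t* = A' *m diag_mx (\row_i (a 0 i)^-1).
      by rewrite /R /conjd /A' !mulmxA -[LHS]mulmxA (unitarymxP uV) mulmx1.
    by rewrite mulV -{1}(mxtrace_unitary (A *m R *m (A *m R)) (U := V^t*)) ?trmxC_unitary // trmxCK.
  apply: eq_bigr => i _; rewrite mxE; apply: eq_bigr => j _.
  have : A' j i = (A' i j)^* by rewrite -{1}hA' !mxE.
  generalize A' => B hB; rewrite !mul_mx_diag !mxE hB normCK invfM; ring.
have rowZ i : \sum_j `|Z' i j| ^+ 2 = 1.
  have -> : \sum_j `|Z' i j| ^+ 2 = (Z' *m Z'^t*) i i.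
    by rewrite mxE; apply: eq_bigr => j _; rewrite !mxE normCK.
  by rewrite hZ' mulV ZZ mulmx1 (unitarymxP uV) mxE eqxx.
rewrite -[tnorm A]ger0_norm ?tnorm_ge0 // eZ eZ'.
apply: (@le_trans _ _ (\sum_i \sum_j `|Z' i j| * `|A' i j|)).
  apply: le_trans (ler_norm_sum _ _ _) _; apply: ler_sum => i _.
  apply: le_trans (ler_norm_sum _ _ _) _; apply: ler_sum => j _.
  by rewrite normrM symA.
(* Each product is split with weight [c * (a 0 i * a 0 j)]; the factor [a 0 i * a 0 j] in front of
   the entry of [Z'] is then bounded by the mean of the two squares. *)
apply: (@le_trans _ _ (\sum_i \sum_j 2^-1 * (c * (2^-1 * (a 0 i ^+ 2 + a 0 j ^+ 2) * `|Z' i j| ^+ 2)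
     + c^-1 * ((a 0 i * a 0 j)^-1 * `|A' i j| ^+ 2)))).
  apply: ler_sum => i _; apply: ler_sum => j _.
  have ac : 0 < c * (a 0 i * a 0 j) by rewrite !mulr_gt0.
  apply: le_trans (mul_le_weighted_sqr ac _ _) _ => //.
  rewrite ler_pM2l ?invr_gt0 ?ltr0n // invfM [in X in _ <= X]mulrA lerD2r -mulrA ler_pM2l //.
  rewrite ler_wpM2r ?exprn_ge0 // -[a 0 i * a 0 j]mulr1.
  have := mul_le_weighted_sqr (@ltr01 C) (ltW (a0 i)) (ltW (a0 j)).
  by rewrite invr1 !mul1r mulr1.
have -> : \sum_i \sum_j 2^-1 * (c * (2^-1 * (a 0 i ^+ 2 + a 0 j ^+ 2) * `|Z' i j| ^+ 2)
     + c^-1 * ((a 0 i * a 0 j)^-1 * `|A' i j| ^+ 2)) =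
   2^-1 * (c * (\sum_i \sum_j 2^-1 * (a 0 i ^+ 2 + a 0 j ^+ 2) * `|Z' i j| ^+ 2)
     + c^-1 * \tr (A *m R *m (A *m R))).
  rewrite eR !mulr_sumr -big_split mulr_sumr; apply: eq_bigr => i _ /=.
  by rewrite !mulr_sumr -big_split mulr_sumr.
suff -> : \sum_i \sum_j 2^-1 * (a 0 i ^+ 2 + a 0 j ^+ 2) * `|Z' i j| ^+ 2 =
    \sum_i a 0 i ^+ 2 by [].
have E : \sum_i \sum_j a 0 i ^+ 2 * `|Z' i j| ^+ 2 = \sum_i a 0 i ^+ 2.
  by apply: eq_bigr => i _; rewrite -mulr_sumr rowZ mulr1.
(* The rows of [Z'] have norm 1, and so do its columns, because the moduli of its entries are
   symmetric. *)
transitivity (2^-1 * (\sum_i \sum_j a 0 i ^+ 2 * `|Z' i j| ^+ 2 +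
                      \sum_i \sum_j a 0 j ^+ 2 * `|Z' i j| ^+ 2)).
  rewrite -big_split mulr_sumr; apply: eq_bigr => i _ /=.
  by rewrite -big_split mulr_sumr; apply: eq_bigr => j _ /=; ring.
rewrite [X in _ + X]exchange_big /= E.
under [X in _ + X]eq_bigr => i _ do under eq_bigr => j _ do rewrite symZ.
by rewrite E; field.
Qed.

(* The term [eta] makes [rho'] invertible, so that no pseudo-inverse is needed. *)
Lemma pretty_good_measurement n (X : finType) (rho : X -> 'M[C]_n) (eta : C) :
  0 < eta -> (forall x, psdm (rho x)) ->
  exists F : X -> 'M[C]_n, [/\ forall x, psdm (F x), psdm (1%:M - \sum_x F x) &
    forall (f : X -> C) (c : C), (forall x, f x \is Num.real) -> 0 < c ->
    tnorm (\sum_x f x *: rho x) <= 2^-1 * (c * (\sum_x \tr (rho x) + eta * n%:R)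
        + c^-1 * \sum_x \sum_x' f x * f x' * \tr (rho x *m F x'))].
Proof.
move=> eta0 hr; pose rho' := \sum_x rho x + eta%:M.
have heta : psdm (eta%:M : 'M[C]_n).
  by rewrite -diag_const_mx; apply: psdm_diag => i; rewrite mxE ltW.
have hr' : psdm rho' by apply: psdmD => //; apply: psdm_sum.
have [uV _ eV] := spectral_herm (psdm_herm hr').
set V := spectralmx rho' in uV eV; set p := spectral_diag rho' in eV.
have p0 i : 0 < p 0 i.
  apply: lt_le_trans eta0 _.
  have -> : p 0 i = (V *m rho' *m V^t*) i i.
    by rewrite {1}eV !mulmxA (unitarymxP uV) mul1mx -mulmxA (unitarymxP uV) mulmx1 mxE eqxx.
  rewrite /rho' mulmxDr mulmxDl mul_mx_scalar -scalemxAl (unitarymxP uV) mxE [X in _ + X]mxE.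
  rewrite [_%:M i i]mxE eqxx mulr1 lerDr.
  have /(psdm_conj (V^t*)) : psdm (\sum_x rho x) by apply: psdm_sum.
  by rewrite trmxCK => /psdm_entry; apply.
have [a a0 aa] : exists2 a : 'rV[C]_n, forall i, 0 < a 0 i & forall i, a 0 i ^+ 2 = p 0 i.
  by exists (\row_i sqrtC (p 0 i)) => i; rewrite mxE ?sqrtC_gt0 ?sqrtCK.
(* [R] is the inverse square root of [rho']. The defect of the measurement below is
   [R *m eta%:M *m R], hence positive semidefinite. *)
pose R := conjd V (\row_i (a 0 i)^-1).
have hR : R^t* = R by apply: conjd_adj => i; rewrite mxE rpredV ger0_real // ltW.
have RrR : R *m rho' *m R = 1%:M.
  rewrite {1}eV -/(conjd V p) !conjdM // -(conjd1 uV); congr conjd; apply/rowP => i.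
  by rewrite !mxE -aa; field; rewrite gt_eqF.
exists (fun x => R *m rho x *m R); split.
- by move=> x; rewrite -{1}hR; apply: psdm_conj.
- rewrite -mulmx_suml -mulmx_sumr -RrR -mulmxBl -mulmxBr /rho' addrAC subrr add0r.
  by rewrite -{1}hR; apply: psdm_conj.
move=> f c rf c0.
have hA : (\sum_x f x *: rho x)^t* = \sum_x f x *: rho x.
  rewrite [in LHS]raddf_sum raddf_sum; apply: eq_bigr => x _.
  by rewrite /= adjmxZ psdm_herm // conj_Creal.
apply: le_trans (tnorm_weighted hA uV a0 c0) _.
rewrite le_eqVlt; apply/orP; left; apply/eqP; congr (_ * (_ * _ + _ * _)).
  under eq_bigr => i _ do rewrite aa.
  rewrite -mxtrace_diag -(mxtrace_unitary (diag_mx p) uV) -eV /rho' raddfD /= mxtrace_scalar.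
  by rewrite raddf_sum mulr_natr.
rewrite !mulmx_suml raddf_sum; apply: eq_bigr => x _ /=.
rewrite !mulmx_sumr raddf_sum; apply: eq_bigr => x' _ /=.
rewrite -!scalemxAl -!scalemxAr !linearZ /= mulrA; congr (_ * _).
by rewrite !mulmxA.
Qed.

(** No eigenvalue exceeds the sum of all of them. This provides a feasible point in the definition
    of the quantum min-entropy. *)
Lemma psdm_tr_sub n (A : 'M[C]_n) : psdm A -> psdm ((\tr A)%:M - A).
Proof.
move=> hA; have [uU _ eA] := spectral_herm (psdm_herm hA).
have D0 i := psdm_spectral_diag_ge0 i hA.
set U := spectralmx A in uU eA; set D := spectral_diag A in D0 eA.
have -> : (\tr A)%:M - A = conjd U (\row_i (\tr A - D 0 i)).
  rewrite {2}eA /conjd; have -> : (\row_i (\tr A - D 0 i)) = const_mx (\tr A) - D.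
    by apply/rowP => i; rewrite !mxE.
  by rewrite linearB /= mulmxBr mulmxBl diag_const_mx mul_mx_scalar -scalemxAl unitary_adjM // scalemx1.
apply: psdm_diag_adj => i; rewrite mxE subr_ge0 eA mxtrace_unitary // mxtrace_diag.
by rewrite (bigD1 i) //= lerDl sumr_ge0.
Qed.

End PsdMatrices.

(** * Matrices of the statement as MathComp matrices *)

Local Notation CC := (complex R).
Local Notation cRe := (@complex.Re R).
Local Notation cIm := (@complex.Im R).

Definition cc (z : cplx) : CC := Complex (re z) (im z).
Definition uncc (z : CC) : cplx := Cx (cRe z) (cIm z).

Lemma unccK z : cc (uncc z) = z. Proof. by case: z. Qed.
Lemma cc_inj : injective cc. Proof. by case=> [a b] [c d] [-> ->]. Qed.
Lemma ccD a b : cc (Cadd a b) = cc a + cc b. Proof. by []. Qed.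
Lemma ccM a b : cc (Cmul a b) = cc a * cc b. Proof. by []. Qed.
Lemma ccN a : cc (Copp a) = - cc a. Proof. by []. Qed.
Lemma cc_CofR x : cc (CofR x) = (x%:C)%C. Proof. by []. Qed.
Lemma cc0 : cc C0 = 0. Proof. by []. Qed.
Lemma cc_sum (T : finType) (F : T -> cplx) : cc (Csum F) = \sum_i cc (F i).
Proof. by rewrite /Csum (big_morph cc ccD cc0). Qed.

Lemma Re_sum (I : Type) (r : seq I) (P : pred I) (F : I -> CC) :
  cRe (\sum_(i <- r | P i) F i) = \sum_(i <- r | P i) cRe (F i).
Proof. by apply: (big_morph cRe) => [[a b] [c d]|]. Qed.

Lemma mxtrace_bigsum n (I : Type) (r : seq I) (P : pred I) (F : I -> 'M[CC]_n) :
  \tr (\sum_(i <- r | P i) F i) = \sum_(i <- r | P i) \tr (F i).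
Proof. exact: raddf_sum. Qed.

Lemma ReB (x y : CC) : cRe (x - y) = cRe x - cRe y.
Proof. by case: x y => [a b] [c d]. Qed.

Lemma real_complexD (x y : R) : ((x + y)%:C)%C = (x%:C)%C + (y%:C)%C :> CC.
Proof. exact: rmorphD. Qed.
Lemma real_complexM (x y : R) : ((x * y)%:C)%C = (x%:C)%C * (y%:C)%C :> CC.
Proof. exact: rmorphM. Qed.
Lemma real_complexV (x : R) : ((x^-1)%:C)%C = ((x%:C)%C)^-1 :> CC.
Proof. exact: fmorphV. Qed.
Lemma real_complex_nat k : ((k%:R)%:C)%C = k%:R :> CC.
Proof. exact: (rmorph_nat (real_complex R)). Qed.
Lemma real_complex_sum (I : Type) (r : seq I) (P : pred I) (F : I -> R) :
  ((\sum_(i <- r | P i) F i)%:C)%C = \sum_(i <- r | P i) ((F i)%:C)%C :> CC.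
Proof. exact: rmorph_sum. Qed.

Lemma ReCM (a : R) (z : CC) : cRe ((a%:C)%C * z) = a * cRe z.
Proof. by case: z => x y /=; rewrite mul0r subr0. Qed.

Lemma Re_le (x y : CC) : x <= y -> cRe x <= cRe y.
Proof. by rewrite lecE => /andP[]. Qed.

Lemma Re_ge0 (x : CC) : 0 <= x -> 0 <= cRe x.
Proof. exact: Re_le. Qed.

Lemma ReK (x : CC) : 0 <= x -> ((cRe x)%:C)%C = x.
Proof. by move=> h; apply: RRe_real; apply: ger0_real. Qed.

Lemma sum_enum_val (T : finType) (V : zmodType) (F : T -> V) :
  \sum_(i < #|T|) F (enum_val i) = \sum_x F x.
Proof. by rewrite -(big_enum_val _ (A := T)). Qed.

Lemma sum_pair (I T : finType) (V : zmodType) (F : I * T -> V) :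
  \sum_p F p = \sum_i \sum_t F (i, t).
Proof. by rewrite pair_bigA; apply: eq_bigr => -[]. Qed.

Definition toM (T : finType) (A : mx T) : 'M[CC]_#|T| :=
  \matrix_(i, j) cc (A (enum_val i) (enum_val j)).
Definition fromM (T : finType) (M : 'M[CC]_#|T|) : mx T :=
  fun x y => uncc (M (enum_rank x) (enum_rank y)).

Section Bridge.
Variable T : finType.
Implicit Types A B : mx T.

Lemma fromMK M : toM (@fromM T M) = M.
Proof. by apply/matrixP => i j; rewrite !mxE unccK !enum_valK. Qed.

Lemma toME A s t : toM A (enum_rank s) (enum_rank t) = cc (A s t).
Proof. by rewrite mxE !enum_rankK. Qed.

Lemma toM_inj A B : toM A = toM B -> A = B.
Proof.
move=> e; apply: functional_extensionality => s; apply: functional_extensionality => t.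
by apply: cc_inj; rewrite -!toME e.
Qed.

Lemma toM_mul A B : toM (mmul A B) = toM A *m toM B.
Proof.
apply/matrixP => i j; rewrite !mxE cc_sum -sum_enum_val.
by apply: eq_bigr => k _; rewrite ccM !mxE.
Qed.

Lemma toM_adj A : toM (madj A) = (toM A)^t*.
Proof. by apply/matrixP => i j; rewrite !mxE. Qed.

Lemma toM_sub A B : toM (msub A B) = toM A - toM B.
Proof. by apply/matrixP => i j; rewrite !mxE. Qed.

Lemma toM_scale c A : toM (mscale c A) = (c%:C)%C *: toM A.
Proof. by apply/matrixP => i j; rewrite !mxE. Qed.

Lemma toM_id : toM (@mid T) = 1%:M.
Proof.
by apply/matrixP => i j; rewrite !mxE /mid (inj_eq enum_val_inj); case: eqP.
Qed.

Lemma cc_mtr A : cc (mtr A) = \tr (toM A).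
Proof. by rewrite cc_sum -sum_enum_val; apply: eq_bigr => i _; rewrite mxE. Qed.

Lemma psdmP (M : 'M[CC]_#|T|) : psdm M <->
  forall v : T -> CC, 0 <= \sum_s \sum_t v s * M (enum_rank s) (enum_rank t) * (v t)^*.
Proof.
have E (v : T -> CC) (u : 'rV[CC]_#|T|) : (forall i, u 0 i = v (enum_val i)) ->
    (u *m M *m u^t*) 0 0 = \sum_s \sum_t v s * M (enum_rank s) (enum_rank t) * (v t)^*.
  move=> uv; rewrite qformE -[RHS]sum_enum_val; apply: eq_bigr => i _.
  by rewrite -[RHS]sum_enum_val; apply: eq_bigr => j _; rewrite !uv !enum_valK.
split=> h v.
  by rewrite -(E v (\row_i v (enum_val i))) // => i; rewrite mxE.
by rewrite (E (fun s => v 0 (enum_rank s))) // => i; rewrite enum_valK.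
Qed.

(** [qform] conjugates the left vector and [psdm] the right one, so the test vectors on the two
    sides correspond through conjugation. *)
Lemma psdP A : psd A <-> psdm (toM A).
Proof.
rewrite psdmP; have E v : cc (qform A v) =
    \sum_s \sum_t (cc (v s))^* * toM A (enum_rank s) (enum_rank t) * ((cc (v t))^*)^*.
  rewrite cc_sum; apply: eq_bigr => s _; rewrite cc_sum; apply: eq_bigr => t _.
  by rewrite toME conjCK.
split=> h v.
  have [h1 h2] := h (fun t => uncc (v t)^*).
  have <- : cc (qform A (fun t => uncc (v t)^*)) =
    \sum_s \sum_t v s * toM A (enum_rank s) (enum_rank t) * (v t)^*.
    by rewrite E; apply: eq_bigr => s _; apply: eq_bigr => t _; rewrite !unccK !conjCK.
  by rewrite lecE /= h2 eqxx /=; apply/RleP.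
have := h (fun t => (cc (v t))^*); rewrite -E lecE /= => /andP[/eqP h1 /RleP h2].
by split.
Qed.

(** [msqrt] is a choice among positive semidefinite square roots; existence is given by [B], and
    uniqueness identifies the chosen root with [B]. *)
Lemma trnormE A (B : 'M[CC]_#|T|) : psdm B -> B *m B = (toM A)^t* *m toM A -> trnorm A = cRe (\tr B).
Proof.
move=> pB eB.
have [] := epsilon_spec (inhabits (fun _ _ => C0 : cplx))
  (fun B : mx T => psd B /\ mmul B B = mmul (madj A) A).
  exists (fromM B); split; first by apply/psdP; rewrite fromMK.
  by apply: toM_inj; rewrite !toM_mul fromMK toM_adj.
rewrite -/(msqrt _) => /psdP p1 e1; rewrite /trnorm.
have -> : re (mtr (msqrt (mmul (madj A) A))) = cRe (cc (mtr (msqrt (mmul (madj A) A)))) by [].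
rewrite cc_mtr (@psdm_sqrt_uniq _ _ (toM (msqrt (mmul (madj A) A))) B) //.
by rewrite -toM_mul e1 eB toM_mul toM_adj.
Qed.

Definition tn n (M : 'M[CC]_n) : R := cRe (tnorm M).

Lemma trnorm_tn A : (toM A)^t* = toM A -> trnorm A = tn (toM A).
Proof.
by move=> hA; rewrite (trnormE (absm_psdm (toM A))) ?tr_absm // absm_sqr // hA.
Qed.

End Bridge.

(** * Triangle inequality, block-diagonal matrices, and measurement statistics *)

Lemma tn_ge0 n (M : 'M[CC]_n) : 0 <= tn M.
Proof. exact/Re_ge0/tnorm_ge0. Qed.

Lemma tn_le n (A P : 'M[CC]_n) : A^t* = A -> psdm (P - A) -> psdm (P + A) -> tn A <= cRe (\tr P).
Proof. by move=> hA hm hp; exact: Re_le (tnorm_le hA hm hp). Qed.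

(** The matrix [Q], the weighted sum of the absolute values, dominates the sum with either sign, so
    [tn_le] applies without diagonalising the sum. *)
Lemma tn_sum n (I : finType) (P : pred I) (A : I -> 'M[CC]_n) (a : I -> R) :
  (forall i, (A i)^t* = A i) ->
  tn (\sum_(i | P i) ((a i)%:C)%C *: A i) <= \sum_(i | P i) `|a i| * tn (A i).
Proof.
move=> hA; pose Q := \sum_(i | P i) ((`|a i|)%:C)%C *: absm (A i).
have bound i (s : bool) : psdm ((`|a i|%:C)%C *: absm (A i) + (-1) ^+ s *: (((a i)%:C)%C *: A i)).
  (* The sign of the coefficient is merged with the external sign, which leaves only [absm (A i)]
     plus or minus [A i]. *)
  pose s' := s (+) (a i < 0).
  have -> : (`|a i|%:C)%C *: absm (A i) + (-1) ^+ s *: (((a i)%:C)%C *: A i) =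
     (`|a i|%:C)%C *: (absm (A i) + (-1) ^+ s' *: A i).
    rewrite scalerDr !scalerA; congr (_ + _ *: _).
    rewrite {1}(numEsign (a i)) /s' signr_addb rmorphM rmorph_sign.
    by ring.
  apply: psdmZ; first by rewrite ler0c.
  case: s'; rewrite ?expr1 ?expr0 ?scaleN1r ?scale1r; first exact: absm_subl.
  exact: absm_addl.
have -> : \sum_(i | P i) `|a i| * tn (A i) = cRe (\tr Q).
  rewrite /Q mxtrace_bigsum Re_sum; apply: eq_bigr => i _ /=.
  by rewrite mxtraceZ ReCM tr_absm.
apply: tn_le.
- rewrite [in LHS]raddf_sum raddf_sum; apply: eq_bigr => i _ /=.
  by rewrite adjmxZ hA; congr (_ *: _); apply: conjc_real.
- rewrite /Q -sumrB; apply: psdm_sum => i _.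
  by have := bound i true; rewrite expr1 scaleN1r.
- rewrite /Q -big_split /=; apply: psdm_sum => i _.
  by have := bound i false; rewrite expr0 scale1r.
Qed.

Lemma psdm_blocks (I T : finType) (D : I -> 'M[CC]_#|T|) (A : 'M[CC]_#|{: I * T}|) :
  (forall i, psdm (D i)) ->
  (forall p q, A (enum_rank p) (enum_rank q) =
     if p.1 == q.1 then D p.1 (enum_rank p.2) (enum_rank q.2) else 0) ->
  psdm A.
Proof.
move=> hD eA; apply/psdmP => v.
have -> : \sum_s \sum_t v s * A (enum_rank s) (enum_rank t) * (v t)^* =
   \sum_i \sum_s \sum_t v (i, s) * D i (enum_rank s) (enum_rank t) * (v (i, t))^*.
  rewrite [RHS]pair_big /=; apply: eq_bigr => -[i s] _ /=.
  rewrite sum_pair.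
  rewrite (bigD1 i) //= [X in _ + X]big1 ?addr0 => [|j ji].
    by apply: eq_bigr => t _; rewrite eA /= eqxx.
  by apply: big1 => t _; rewrite eA /= eq_sym (negPf ji) mulr0 mul0r.
by rewrite sumr_ge0 // => i _; have /psdmP := hD i; apply.
Qed.

(** The dominating matrix is block diagonal, with the absolute values of the blocks [D i] as its
    blocks. *)
Lemma trnorm_blocks (I T : finType) (D : I -> 'M[CC]_#|T|) (A : mx (I * T)%type) :
  (forall i, (D i)^t* = D i) ->
  (forall p q, cc (A p q) =
     if p.1 == q.1 then D p.1 (enum_rank p.2) (enum_rank q.2) else 0) ->
  trnorm A <= \sum_i tn (D i).
Proof.
move=> hD eA.
have hA : (toM A)^t* = toM A.
  apply/matrixP => i j; rewrite -(enum_valK i) -(enum_valK j).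
  move: (enum_val i) (enum_val j) => p q; rewrite mxE [_^T _ _]mxE !toME !eA eq_sym.
  by case: eqP => [->|_]; rewrite ?conjC0 // -[in RHS]hD !mxE.
pose P : 'M[CC]_#|{: I * T}| := \matrix_(i, j) let p := enum_val i in let q := enum_val j in
  if p.1 == q.1 then absm (D p.1) (enum_rank p.2) (enum_rank q.2) else 0.
have eP p q : P (enum_rank p) (enum_rank q) =
   if p.1 == q.1 then absm (D p.1) (enum_rank p.2) (enum_rank q.2) else 0.
  by rewrite mxE /= !enum_rankK.
have -> : \sum_i tn (D i) = cRe (\tr P).
  rewrite /mxtrace Re_sum.
  transitivity (\sum_(i < #|{: I * T}|) cRe (P (enum_rank (enum_val i)) (enum_rank (enum_val i)))).
    rewrite (sum_enum_val (fun p : I * T => cRe (P (enum_rank p) (enum_rank p)))).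
    rewrite sum_pair.
    apply: eq_bigr => i _; rewrite /tn -tr_absm /mxtrace Re_sum.
    rewrite -[RHS](sum_enum_val (fun t => cRe (P (enum_rank (i, t)) (enum_rank (i, t))))).
    by apply: eq_bigr => k _; rewrite eP /= eqxx !enum_valK.
  by apply: eq_bigr => i _; rewrite enum_valK.
have eAP p q : toM A (enum_rank p) (enum_rank q) =
    if p.1 == q.1 then D p.1 (enum_rank p.2) (enum_rank q.2) else 0 by rewrite toME eA.
rewrite trnorm_tn //; apply: tn_le => //.
  apply: (@psdm_blocks _ _ (fun i => absm (D i) - D i)) => [i|p q]; first exact: absm_subl.
  by rewrite mxE [in X in _ + X]mxE eP eAP; case: eqP => _; rewrite ?mxE ?[in RHS]mxE ?subrr.
apply: (@psdm_blocks _ _ (fun i => absm (D i) + D i)) => [i|p q]; first exact: absm_addl.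
by rewrite mxE eP eAP; case: eqP => _; rewrite ?addr0 // [RHS]mxE.
Qed.

Lemma trnorm_diag (T : finType) (A : mx T) (d : T -> R) :
  (forall s t, cc (A s t) = if s == t then ((d s)%:C)%C else 0) ->
  trnorm A = \sum_s `|d s|.
Proof.
move=> eA; pose D (f : T -> R) : 'M[CC]_#|T| := diag_mx (\row_i ((f (enum_val i))%:C)%C).
have eD : toM A = D d.
  apply/matrixP => i j; rewrite !mxE eA (inj_eq enum_val_inj).
  by case: eqP => [->|]; rewrite ?mulr1n ?mulr0n.
have hD : (D d)^t* = D d.
  apply/matrixP => i j; rewrite !mxE eq_sym; case: eqP => [->|_].
    by rewrite !mulr1n; apply: conjc_real.
  by rewrite !mulr0n conjC0.
rewrite (@trnormE _ A (D (fun s => `|d s|))) ?eD ?hD.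
- rewrite mxtrace_diag Re_sum -[RHS]sum_enum_val; apply: eq_bigr => i _; rewrite mxE //.
- by apply: psdm_diag => i; rewrite mxE ler0c.
- rewrite !mulmx_diag; congr diag_mx; apply/rowP => i; rewrite !mxE -!rmorphM /=.
  by rewrite -!expr2 real_normK ?num_real.
Qed.

(* [p x x'] is the joint law of [x] and of the outcome [x'] of the pretty good
   measurement, and [q] the law of its outcome on [sigma]. *)
Lemma measurement_table n (X : finType) (rho : X -> 'M[CC]_n) (eta : R) :
  0 < eta -> (forall x, psdm (rho x)) ->
  exists p : X -> X -> R, [/\ forall x x', 0 <= p x x',
    forall x, \sum_x' p x x' <= cRe (\tr (rho x)),
    forall (mu : R) (sigma : 'M[CC]_n), psdm sigma ->
      (forall x, psdm ((mu%:C)%C *: sigma - rho x)) ->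
      exists q : X -> R, [/\ forall x', 0 <= q x', \sum_x' q x' <= cRe (\tr sigma) &
         forall x x', p x x' <= mu * q x'] &
    forall (f : X -> R) (c : R), 0 < c ->
    tn (\sum_x ((f x)%:C)%C *: rho x) <= 2^-1 * (c * (\sum_x cRe (\tr (rho x)) + eta * n%:R)
        + c^-1 * \sum_x \sum_x' f x * f x' * p x x')].
Proof.
move=> eta0 hr; have eta0' : 0 < ((eta%:C)%C : CC) by rewrite ltcR.
have [F [hF hF1 hN]] := pretty_good_measurement eta0' hr.
pose p x x' := cRe (\tr (rho x *m F x')).
have sumF (s : 'M[CC]_n) : psdm s -> \sum_x cRe (\tr (s *m F x)) <= cRe (\tr s).
  move=> hs; have := Re_ge0 (psdm_trM_ge0 hs hF1).
  rewrite mulmxBr mulmx1 raddfB /= mulmx_sumr mxtrace_bigsum ReB subr_ge0 Re_sum.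
  exact.
have pE x x' : ((p x x')%:C)%C = \tr (rho x *m F x').
  exact: (ReK (psdm_trM_ge0 (hr x) (hF x'))).
exists p; split.
- by move=> x x'; exact: (Re_ge0 (psdm_trM_ge0 (hr x) (hF x'))).
- by move=> x; exact: (sumF _ (hr x)).
- move=> mu sigma hs hmu; exists (fun x' => cRe (\tr (sigma *m F x'))); split.
  + by move=> x'; exact: (Re_ge0 (psdm_trM_ge0 hs (hF x'))).
  + exact: (sumF _ hs).
  (* Tracing the operator inequality between [rho x] and [sigma] against the measurement operator
     [F x'] turns it into an inequality between probabilities. *)
  + move=> x x'; have := Re_ge0 (psdm_trM_ge0 (hmu x) (hF x')).
    rewrite mulmxBl raddfB /= ReB -scalemxAl mxtraceZ ReCM subr_ge0; exact.
move=> f c c0; have c0' : 0 < ((c%:C)%C : CC) by rewrite ltcR.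
have rf x : (((f x)%:C)%C : CC) \is Num.real by rewrite complex_real.
apply: le_trans (Re_le (hN (fun x => ((f x)%:C)%C) _ rf c0')) _.
rewrite le_eqVlt; apply/orP; left; apply/eqP.
have -> : 2^-1 * ((c%:C)%C * (\sum_x \tr (rho x) + (eta%:C)%C * n%:R) +
   ((c%:C)%C)^-1 * (\sum_x \sum_x' (f x)%:C%C * (f x')%:C%C * \tr (rho x *m F x'))) =
   ((2^-1 * (c * (\sum_x cRe (\tr (rho x)) + eta * n%:R)
        + c^-1 * \sum_x \sum_x' f x * f x' * p x x'))%:C)%C :> CC.
  rewrite !(real_complexM, real_complexD, real_complexV, real_complex_nat, real_complex_sum).
  congr (_ * (_ * (_ + _) + _ * _)).
    by apply: eq_bigr => x _; rewrite ReK // psdm_tr_ge0.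
  apply: eq_bigr => x _; rewrite real_complex_sum; apply: eq_bigr => x' _ /=.
  by rewrite !real_complexM pE.
by [].
Qed.

(** * Min-entropies *)

Lemma psdm_block (X E : finType) (A : mx (X * E)%type) x : psdm (toM A) -> psdm (toM (block A x)).
Proof.
move=> /psdmP h; apply/psdmP => v.
have := h (fun p => if p.1 == x then v p.2 else 0).
congr (0 <= _); rewrite sum_pair (bigD1 x) //= [X in _ + X]big1 ?addr0 => [|x' nx]; last first.
  by apply: big1 => s _; apply: big1 => t _; rewrite (negPf nx) !mul0r.
apply: eq_bigr => s _; rewrite sum_pair (bigD1 x) //= [X in _ + X]big1 ?addr0 => [|x' nx]; last first.
  by apply: big1 => t _; rewrite (negPf nx) conjC0 mulr0.
by apply: eq_bigr => t _; rewrite !eqxx !toME.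
Qed.

Lemma cc_mid (T : finType) (i j : T) : cc (@mid T i j) = (i == j)%:R.
Proof. by rewrite /mid; case: eqP. Qed.

Lemma cc_proj (T : finType) (z i j : T) : cc (proj z i j) = ((i == z) && (j == z))%:R.
Proof. by rewrite /proj; case: ifP. Qed.

Lemma cc_diagmx (T : finType) (P : T -> R) i j : cc (diagmx P i j) = (i == j)%:R * ((P i)%:C)%C.
Proof. by rewrite /diagmx; case: eqP => _; rewrite ?mul1r ?mul0r. Qed.

Lemma Rpower2_gt0 x : 0 < Rpower 2 x.
Proof. by apply/RltP; apply: exp_pos. Qed.

Lemma ln2_gt0 : 0 < ln 2.
Proof. by apply/RltP; apply: (@Rlt_trans (IZR 0) (Rinv (IZR 2))); [Lra.lra | exact: ln_lt_2]. Qed.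

Lemma Rpower2D x y : Rpower 2 (x + y) = Rpower 2 x * Rpower 2 y.
Proof. exact: Rpower_plus. Qed.

Lemma Rpower2_le x y : x <= y -> Rpower 2 x <= Rpower 2 y.
Proof. by move=> /RleP h; apply/RleP; apply: Rle_Rpower => //; Lra.lra. Qed.

Lemma Rpower2_log2 x : 0 < x -> Rpower 2 (log2 x) = x.
Proof.
move=> /RltP x0; rewrite /Rpower /log2 RmultE RdivE divfK ?exp_ln //.
by rewrite gt_eqF // ln2_gt0.
Qed.

Lemma log2_le x y : 0 < x -> x <= y -> log2 x <= log2 y.
Proof.
move=> x0 xy; rewrite /log2 !RdivE ler_pM2r ?invr_gt0 ?ln2_gt0 //.
move: xy; rewrite le_eqVlt => /orP[/eqP -> //|/RltP xy].
by apply/RleP/Rlt_le/ln_increasing => //; apply/RltP.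
Qed.

Lemma log2_Rpower x : log2 (Rpower 2 x) = x.
Proof.
rewrite /log2 /Rpower ln_exp RmultE RdivE mulfK //.
by rewrite gt_eqF // ln2_gt0.
Qed.

Lemma Rmax_fun : Rmax = Num.max :> (R -> R -> R).
Proof.
by apply: functional_extensionality => x; apply: functional_extensionality => y; rewrite RmaxE.
Qed.

Lemma is_distrP (T : finType) (P : T -> R) : is_distr P <-> (forall x, 0 <= P x) /\ \sum_x P x = 1.
Proof.
split=> -[h1 h2]; split=> // x; first exact/RleP.
by apply/RleP; apply: h1.
Qed.

(** Positivity keeps [log2] in the domain where it inverts [Rpower 2], away from the default values
    of [ln]. *)
Lemma bigmax_distr_gt0 (T : finType) (P : T -> R) : is_distr P -> 0 < \big[Rmax/0]_x P x.
Proof.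
move=> /is_distrP[h0 h1]; rewrite Rmax_fun.
have [x px] : exists x, 0 < P x.
  apply/existsP; apply: contraT; rewrite negb_exists => /forallP h.
  have : \sum_x P x = 0 by apply: big1 => x _; apply/eqP; rewrite eq_le h0 andbT leNgt h.
  by rewrite h1 => /eqP; rewrite oner_eq0.
exact: lt_le_trans px (le_bigmax _ _ _).
Qed.

Lemma Hmin_cl_le (T : finType) (P : T -> R) (k : R) : is_distr P ->
  (forall x, P x <= Rpower 2 (- k)) -> k <= Hmin_cl P.
Proof.
move=> hP hk; rewrite /Hmin_cl RoppE lerNr -[- k]log2_Rpower.
apply: log2_le; first exact: bigmax_distr_gt0.
by rewrite Rmax_fun; apply: bigmax_le => // ; rewrite ltW // Rpower2_gt0.
Qed.

Lemma Hmin_cl_ge (T : finType) (P : T -> R) (k : R) y : is_distr P ->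
  k <= Hmin_cl P -> P y <= Rpower 2 (- k).
Proof.
move=> hP; rewrite /Hmin_cl RoppE lerNr => h.
apply: (@le_trans _ _ (\big[Rmax/0]_x P x)); first by rewrite Rmax_fun le_bigmax.
by rewrite -[X in X <= _]Rpower2_log2 ?bigmax_distr_gt0 //; apply: Rpower2_le.
Qed.

Lemma toM_block_witness (X E : finType) (rho : mx (X * E)%type) (c : R) (sigma : mx E) x :
  toM (block (msub (mscale c (mtensor (@mid X) sigma)) rho) x) =
  ((c%:C)%C *: toM sigma - toM (block rho x)).
Proof.
apply/matrixP => i j; rewrite !mxE /block /msub /mscale /mtensor /=.
by rewrite ccD ccN !ccM cc_mid eqxx mul1r.
Qed.

(** The min-entropy is a supremum, and a feasible [lam] within 1 of it exists without any
    compactness argument. That unit of entropy is the factor 2 in the bound on [mu]. As [Hmin_q] is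
    a choice of least upper bound, the feasible set must first be shown nonempty and bounded. *)
Lemma Hmin_q_witness (X E : finType) (rho : mx (X * E)%type) (k : R) :
  density rho -> k <= Hmin_q rho ->
  exists (mu : R) (sigma : 'M[CC]_#|E|),
    [/\ 0 <= mu, mu <= 2 * Rpower 2 (- k), psdm sigma, \tr sigma = 1 &
       forall x, psdm ((mu%:C)%C *: sigma - toM (block rho x))].
Proof.
move=> [prho trho] hk.
pose L lam := exists sigma : mx E, density sigma /\
  psd (msub (mscale (Rpower 2 (- lam)) (mtensor (@mid X) sigma)) rho).
have trho1 : \tr (toM rho) = 1 by rewrite -cc_mtr trho.
have toM_tensor_id : toM (mtensor (@mid X) (@mid E)) = 1%:M.
  apply/matrixP => i j; rewrite !mxE /mtensor ccM !cc_mid -natrM mulnb.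
  by rewrite -(inj_eq enum_val_inj) -pair_eqE.
have E0 : (0 < #|E|)%N.
  rewrite lt0n; apply/eqP => E0; have : #|{: X * E}| = 0%N by rewrite card_prod E0 muln0.
  move=> XE0; move: trho1; rewrite /mxtrace big1 => [/esym/eqP|i _]; first by rewrite oner_eq0.
  by have := ltn_ord i; rewrite [X in (_ < X)%N]XE0.
have Lne : exists lam, L lam.
  have N0 : 0 < (#|E|%:R : R) by rewrite ltr0n.
  (* With [sigma] maximally mixed and this [lam], the dominating operator is the identity, which
     lies above any operator that is positive semidefinite of trace 1. *)
  exists (- log2 #|E|%:R); exists (mscale (#|E|%:R^-1) (@mid E)); split.
    split; first apply/psdP.
      rewrite toM_scale toM_id; apply: psdmZ; first by rewrite ler0c invr_ge0 ler0n.
      by rewrite -diag_const_mx; apply: psdm_diag => i; rewrite mxE ler01.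
    apply: cc_inj; rewrite cc_mtr toM_scale toM_id mxtraceZ mxtrace1 real_complexV real_complex_nat.
    by rewrite mulVf // pnatr_eq0 -lt0n.
  apply/psdP; rewrite RoppE opprK Rpower2_log2 // toM_sub toM_scale.
  have -> : toM (mtensor (@mid X) (mscale (#|E|%:R^-1) (@mid E))) = ((#|E|%:R^-1)%:C)%C *: 1%:M.
    rewrite -toM_tensor_id; apply/matrixP => i j; rewrite !mxE /mtensor /mscale !ccM.
    by rewrite mulrCA.
  rewrite scalerA -real_complexM divff ?gt_eqF // scale1r.
  by rewrite -trho1; apply: psdm_tr_sub; apply/psdP.
have Lbd : bound L.
  (* Taking traces gives [Rpower 2 lam <= #|X|%:R], and the exponential lies above its tangent
     [1 + lam * ln 2]. *)
  exists (#|X|%:R / ln 2) => lam [sigma [[psig tsig]]] /psdP /psdm_tr_ge0.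
  rewrite -cc_mtr.
  have -> : cc (mtr (msub (mscale (Rpower 2 (- lam)) (mtensor (@mid X) sigma)) rho)) =
      ((Rpower 2 (- lam) * #|X|%:R - 1)%:C)%C.
    rewrite /mtr cc_sum /=.
    have E1 : \sum_i cc (rho i i) = 1 by rewrite -cc_sum -/(mtr rho) trho.
    have E2 : \sum_i cc (sigma i i) = 1 by rewrite -cc_sum -/(mtr sigma) tsig.
    transitivity (\sum_(i : X * E) ((Rpower 2 (- lam))%:C%C * cc (sigma i.2 i.2) - cc (rho i i))).
      by apply: eq_bigr => i _; rewrite /msub /mscale /mtensor ccD ccN !ccM cc_mid eqxx mul1r.
    rewrite sumrB E1 sum_pair /= real_complexD real_complexM real_complex_nat; congr (_ + _); last first.
      by rewrite rmorphN.
    under eq_bigr => x _ do rewrite -mulr_sumr E2 mulr1.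
    by rewrite sumr_const mulr_natr.
  rewrite ler0c subr_ge0 => h; apply/RleP.
  rewrite ler_pdivlMr ?ln2_gt0 //.
  have h2 : Rpower 2 lam <= #|X|%:R.
    have e : Rpower 2 lam * Rpower 2 (- lam) = 1.
      by rewrite -Rpower2D Rplus_opp_r; apply: Rpower_O; Lra.lra.
    by rewrite -(ler_pM2r (Rpower2_gt0 (Ropp lam))) e [X in _ <= X]mulrC.
  apply: le_trans h2; rewrite /Rpower.
  by move/RleP: (exp_ineq1_le (Rmult lam (ln 2))); rewrite RplusE RmultE R1E; lra.
have lub : exists u, is_lub L u by have [u hu] := completeness L Lbd Lne; exists u.
have := epsilon_spec (inhabits 0%R) (is_lub L) lub.
rewrite -/(Hmin_q rho) => -[_ hlub].
(* Otherwise [k - 1] would be an upper bound of the feasible set, hence above its supremum, which is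
   at least [k]. *)
have [lam [hlam Llam]] : exists lam : R, k - 1 < lam /\ L lam.
  apply: NNPP => hn.
  have : is_upper_bound L (k - 1).
    move=> lam hL; apply/RleP; rewrite leNgt; apply/negP; rewrite RminusE R1E => h.
    by apply: hn; exists lam.
  by move=> /hlub /RleP h; have := le_trans hk h; rewrite RminusE R1E; lra.
have [sigma [[psig tsig] hs]] := Llam.
exists (Rpower 2 (- lam)), (toM sigma); split.
- by rewrite ltW // Rpower2_gt0.
- have -> : 2 * Rpower 2 (- k) = Rpower 2 (1 - k).
    by rewrite Rpower2D Rpower_1 //; Lra.lra.
  by apply: Rpower2_le; rewrite RminusE RoppE R1E; lra.
- exact/psdP.
- by rewrite -cc_mtr tsig.
- by move=> x; rewrite -toM_block_witness; apply: psdm_block; apply/psdP.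
Qed.

(** * Extractor states *)

Definition sgb (b : bool) : R := (-1) ^+ b.

Lemma norm_sgb b : `|sgb b| = 1.
Proof. by rewrite /sgb normrX normrN1 expr1n. Qed.

Lemma RpowE2 m : pow 2 m = (2%:R ^+ m : R).
Proof. by rewrite RpowE; congr (_ ^+ _); rewrite IZRposE INRE. Qed.

Lemma cc_cl_ext_state n d m (Ext : bits n -> bits d -> bits m) PX PY p q :
  cc (cl_ext_state Ext PX PY p q) =
  (p == q)%:R * ((PY p.2 * \sum_x PX x * (Ext x p.2 == p.1)%:R)%:C)%C.
Proof.
case: p q => [z v] [z' v'] /=.
rewrite /cl_ext_state /msum cc_sum.
transitivity (\sum_x (((z, v) == (z', v'))%:R * (PX x * PY v * (Ext x v == z)%:R)%:C%C : CC)).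
  apply: eq_bigr => x _; rewrite cc_sum (bigD1 v) //= [X in _ + X]big1 ?addr0 => [|y yv]; last first.
    by rewrite /mscale /mtensor !ccM !cc_proj /= [v == y]eq_sym (negPf yv) !mulr0.
  rewrite /mscale /mtensor !ccM !cc_proj /= eqxx !real_complexM real_complex_nat xpair_eqE.
  rewrite [v' == v]eq_sym [Ext x v == z]eq_sym.
  case: (eqVneq v v') => [_|]; rewrite ?andbF ?mulr0 ?mul0r ?andbT ?mulr1 //.
  case: (eqVneq z (Ext x v)) => [<-|]; rewrite /= ?mulr0 // ?mulr1.
  by rewrite cc_CofR real_complexM mulrC [z' == z]eq_sym.
rewrite -mulr_sumr; congr (_ * _); rewrite -real_complex_sum mulr_sumr; congr ((_%:C)%C).
by apply: eq_bigr => x _; ring.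
Qed.

Lemma cc_rhoU m (z z' : bits m) : cc (rhoU z z') = ((2%:R ^- m)%:C)%C * (z == z')%:R.
Proof. by rewrite /rhoU /mscale ccM cc_mid RinvE RpowE2. Qed.

Lemma sum_bits1 (F : bits 1 -> R) : \sum_z F z = F [tuple false] + F [tuple true].
Proof.
rewrite (bigD1 [tuple false]) //= (bigD1 [tuple true]) //= big1 ?addr0 //.
by case=> [[|[] []]] //= h /andP[]; rewrite -!val_eqE.
Qed.

(** For a single output bit and a fixed seed, both output values deviate from one half by half the
    bias. Their sum is the bias itself, so halving the trace norm accounts for the factor 2. *)
Lemma strong_ext_bias n t (C : bits n -> bits t -> bool) k eps s PX PY :
  strong_ext (one_bit C) k eps s -> is_distr PX -> is_distr PY ->
  (forall x, PX x <= Rpower 2 (- k)) -> (forall v, PY v <= Rpower 2 (- s)) ->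
  \sum_v PY v * `|\sum_x sgb (C x v) * PX x| <= 2 * eps.
Proof.
move=> hC hX hY kX sY.
have := hC PX PY hX hY.
have /RleP kP := Hmin_cl_le hX kX; have /RleP sP := Hmin_cl_le hY sY.
move=> /(_ kP sP) /RleP.
have [X0 X1] := (is_distrP PX).1 hX; have [Y0 Y1] := (is_distrP PY).1 hY.
rewrite (@trnorm_diag _ _ (fun p => PY p.2 *
   (\sum_x PX x * (one_bit C x p.2 == p.1)%:R - 2^-1))); last first.
  move=> p q; rewrite /msub ccD ccN cc_cl_ext_state /mtensor ccM cc_rhoU cc_diagmx.
  case: p q => [z v] [z' v'] /=; rewrite xpair_eqE.
  case: (eqVneq z z') => _ /=; last by rewrite mul0r mulr0 mul0r subrr.
  case: (eqVneq v v') => _ /=; last by rewrite !mul0r mulr0 subrr.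
  rewrite !mul1r mulr1 -real_complexM mulrBr [(2^-1)%R](_ : _ = 2%:R ^- 1) ?expr1 //.
  by rewrite real_complexD [PY v * 2^-1]mulrC -[- (_%:C)%C]rmorphN.
rewrite RmultE RinvE sum_pair exchange_big /=.
have e v : \sum_z `|PY v * (\sum_x PX x * (one_bit C x v == z)%:R - 2^-1)| =
   PY v * `|\sum_x sgb (C x v) * PX x|.
  have E (b : bool) : \sum_x PX x * (one_bit C x v == [tuple b])%:R - 2^-1 =
     sgb b * 2^-1 * \sum_x sgb (C x v) * PX x.
    have h : 2^-1 = \sum_x 2^-1 * PX x :> R by rewrite -mulr_sumr X1 mulr1.
    rewrite [X in _ - X]h mulr_sumr -sumrB; apply: eq_bigr => x _.
    have -> : (one_bit C x v == [tuple b]) = (C x v == b).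
      by rewrite -val_eqE /= eqseq_cons andbT.
    by rewrite /sgb; case: (C x v); case: b; rewrite /= ?expr1 ?expr0; lra.
  have h2 : `|2^-1| = 2^-1 :> R by rewrite ger0_norm // invr_ge0 ler0n.
  rewrite sum_bits1 !E !normrM (ger0_norm (Y0 v)) !norm_sgb h2; lra.
under eq_bigr => v _ do rewrite e.
by move: (\sum_v _) => S; rewrite (_ : IZR 2 = 2%:R) ?IZRposE ?INRE //; lra.
Qed.

Lemma cc_ext_state n d m (E : finType) (Ext : bits n -> bits d -> bits m) PY
    (rho : mx (bits n * E)%type) p q :
  cc (ext_state Ext PY rho p q) =
  (p.1 == q.1)%:R * (((PY p.1.2)%:C)%C *
     \sum_x (Ext x p.1.2 == p.1.1)%:R * toM (block rho x) (enum_rank p.2) (enum_rank q.2)).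
Proof.
case: p q => [[z v] e] [[z' v'] e'] /=.
rewrite /ext_state /msum cc_sum !mulr_sumr; apply: eq_bigr => x _.
rewrite cc_sum (bigD1 v) //= [X in _ + X]big1 ?addr0 => [|y yv]; last first.
  by rewrite /mscale /mtensor !ccM !cc_proj /= [v == y]eq_sym (negPf yv) !(mulr0, mul0r).
rewrite toME /mscale /mtensor !ccM !cc_proj /= eqxx xpair_eqE.
rewrite [v' == v]eq_sym [Ext x v == z]eq_sym.
case: (eqVneq v v') => [_|]; rewrite ?andbF ?mulr0 ?mul0r ?andbT ?mulr1 ?mul0r ?mulr0 //.
case: (eqVneq z (Ext x v)) => [<-|]; rewrite /= ?mul0r ?mulr0 // ?mul1r.
by rewrite [z' == z]eq_sym mulrCA.
Qed.

(** The output and the seed are classical, so the difference of the two states is block diagonal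
    over pairs of an output and a seed. *)
Lemma trnorm_ext_state n d m (E : finType) (Ext : bits n -> bits d -> bits m) PY
    (rho : mx (bits n * E)%type) :
  (forall y, 0 <= PY y) -> (forall x, (toM (block rho x))^t* = toM (block rho x)) ->
  trnorm (msub (ext_state Ext PY rho) (mtensor (mtensor (@rhoU m) (diagmx PY)) (ptrace1 rho)))
  <= \sum_y PY y * \sum_z tn (\sum_x (((Ext x y == z)%:R - 2%:R ^- m)%:C)%C *: toM (block rho x)).
Proof.
move=> Y0 hr.
pose D (p : bits m * bits d) := ((PY p.2)%:C)%C *:
  \sum_x (((Ext x p.2 == p.1)%:R - 2%:R ^- m)%:C)%C *: toM (block rho x).
have hS (a : bits n -> R) : (\sum_x ((a x)%:C)%C *: toM (block rho x))^t* =
    \sum_x ((a x)%:C)%C *: toM (block rho x).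
  rewrite [in LHS]raddf_sum raddf_sum; apply: eq_bigr => x _ /=.
  by rewrite adjmxZ hr; congr (_ *: _); apply: conjc_real.
apply: (@le_trans _ _ (\sum_p tn (D p))).
  apply: trnorm_blocks => [p|p q].
    by rewrite adjmxZ hS; congr (_ *: _); apply: conjc_real.
  rewrite /msub ccD ccN cc_ext_state.
  case: p q => [[z v] e] [[z' v'] e'] /=; rewrite xpair_eqE.
  rewrite /mtensor /= ccM ccM cc_rhoU cc_diagmx /ptrace1 cc_sum.
  case: (eqVneq z z') => _ /=; last by rewrite !(mul0r, mulr0) subrr.
  case: (eqVneq v v') => _ /=; last by rewrite !(mul0r, mulr0) subrr.
  rewrite !(mul1r, mulr1) /D mxE summxE /= [_ * (PY v)%:C%C]mulrC -mulrA -mulrBr; congr (_ * _).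
  rewrite mulr_sumr -sumrB; apply: eq_bigr => x _.
  rewrite [RHS]mxE real_complexD mulrDl real_complex_nat toME; congr (_ + _).
  by rewrite -mulNr -[- (_%:C)%C]rmorphN.
rewrite sum_pair exchange_big /=; apply: ler_sum => y _.
rewrite mulr_sumr; apply: ler_sum => z _.
(* The triangle inequality for a one-term sum serves to pull out the factor [PY y]. *)
have := @tn_sum _ _ xpredT (fun _ : 'I_1 =>
   \sum_x (((Ext x y == z)%:R - 2%:R ^- m)%:C)%C *: toM (block rho x)) (fun _ => PY y).
by rewrite !big_ord1 ger0_norm //; apply.
Qed.

(** * One output bit against quantum side information *)

(** Here [p] is the joint law of the source and one fixed measurement outcome, and [b] stands for
    [Rpower 2 (- k)]. If the conditional law is bounded by [b], the extractor property applies to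
    it. Otherwise one entry exceeds [b] times the total mass, and since entries are at most
    [mu * q], the mass itself is below the second term. *)
Lemma bias_of_table (X V : finType) (PV : V -> R) (f : V -> X -> R) (b mu q eps : R) (p : X -> R) :
  0 < b -> 0 <= eps -> 0 <= mu * q ->
  (forall v, 0 <= PV v) -> \sum_v PV v = 1 -> (forall v x, `|f v x| <= 1) ->
  (forall PX : X -> R, is_distr PX -> (forall x, PX x <= b) ->
     \sum_v PV v * `|\sum_x f v x * PX x| <= 2 * eps) ->
  (forall x, 0 <= p x) -> (forall x, p x <= mu * q) ->
  \sum_v PV v * `|\sum_x f v x * p x| <= 2 * eps * (\sum_x p x) + b^-1 * (mu * q).
Proof.
move=> b0 e0 mq0 V0 V1 f1 hb p0 pq; set P := \sum_x p x.
have bmq : 0 <= b^-1 * (mu * q) by rewrite mulr_ge0 // invr_ge0 ltW.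
have P0 : 0 <= P by rewrite sumr_ge0.
have trivial_bound : \sum_v PV v * `|\sum_x f v x * p x| <= P.
  rewrite -[P]mul1r -V1 mulr_suml; apply: ler_sum => v _; rewrite ler_wpM2l //.
  apply: le_trans (ler_norm_sum _ _ _) _; apply: ler_sum => x _.
  by rewrite normrM (ger0_norm (p0 x)) ler_piMl.
have eP0 : 0 <= 2 * eps * P by rewrite !mulr_ge0 ?ler0n.
have [/forallP good|] := boolP [forall x, p x <= b * P]; last first.
  rewrite negb_forall => /existsP[x]; rewrite -ltNge => bad.
  apply: le_trans trivial_bound _; rewrite -[X in X <= _]add0r lerD //.
  by rewrite ler_pdivlMl // (le_trans (ltW bad)).
have [Pz|Pn] := eqVneq P 0; first by rewrite (le_trans trivial_bound) // Pz mulr0 add0r.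
have Ppos : 0 < P by rewrite lt_def Pn.
have hP : is_distr (fun x => p x / P).
  apply/is_distrP; split=> [x|]; first by rewrite divr_ge0.
  by rewrite -mulr_suml divff.
have := hb _ hP.
have le_b x : p x / P <= b by rewrite ler_pdivrMr // good.
move=> /(_ le_b) h; rewrite -[X in X <= _]addr0 lerD //.
rewrite -ler_pdivrMr // (le_trans _ h) // mulr_suml; apply: ler_sum => v _.
rewrite -mulrA ler_wpM2l // -[X in _ * X]ger0_norm ?invr_ge0 // -normrM mulr_suml.
by under eq_bigr => x _ do rewrite -mulrA.
Qed.

(* The measurement is chosen separately for each value [g0] of the advice [g]:
   this is what makes the advice part of the side information. *)
Lemma advice_class_bound (X V : finType) n (r : X -> 'M[CC]_n) (sigma : 'M[CC]_n)
    (PV : V -> R) (f : V -> X -> R) (A : pred X) (b mu eps eta c : R) :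
  (forall x, psdm (r x)) -> psdm sigma -> cRe (\tr sigma) = 1 -> 0 <= mu ->
  (forall x, psdm ((mu%:C)%C *: sigma - r x)) ->
  0 < b -> 0 <= eps -> 0 < eta -> 0 < c ->
  (forall v, 0 <= PV v) -> \sum_v PV v = 1 -> (forall v x, `|f v x| <= 1) ->
  (forall PX : X -> R, is_distr PX -> (forall x, PX x <= b) ->
     \sum_v PV v * `|\sum_x f v x * PX x| <= 2 * eps) ->
  let T := \sum_(x | A x) cRe (\tr (r x)) in
  \sum_v PV v * tn (\sum_(x | A x) ((f v x)%:C)%C *: r x) <=
    2^-1 * (c * (T + eta * n%:R) + c^-1 * (2 * eps * T + b^-1 * mu)).
Proof.
move=> hr hs ts mu0 hmu b0 e0 eta0 c0 V0 V1 f1 hb /=; set T := \sum_(x | A x) _.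
(* States outside the class are set to zero instead of restricting the type, so that the conditional
   laws remain distributions on all of [X]. *)
pose rA x := if A x then r x else 0.
have hrA x : psdm (rA x) by rewrite /rA; case: (A x); [exact: hr | exact: psdm0].
have hmuA x : psdm ((mu%:C)%C *: sigma - rA x).
  have mu0' : 0 <= ((mu%:C)%C : CC) by rewrite ler0c.
  rewrite /rA; case: (A x); first exact: hmu.
  by rewrite subr0; exact: psdmZ mu0' hs.
have [p [p0 pT pq hN]] := measurement_table eta0 hrA.
have [q [q0 q1 hpq]] := pq mu sigma hs hmuA.
have eT : \sum_x cRe (\tr (rA x)) = T.
  rewrite /T [RHS]big_mkcond; apply: eq_bigr => x _; rewrite /rA.
  by case: (A x) => //; rewrite mxtrace0.
have eA v : \sum_(x | A x) ((f v x)%:C)%C *: r x = \sum_x ((f v x)%:C)%C *: rA x.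
  rewrite big_mkcond; apply: eq_bigr => x _; rewrite /rA.
  by case: (A x) => //; rewrite scaler0.
apply: (@le_trans _ _ (\sum_v PV v * (2^-1 * (c * (T + eta * n%:R)
    + c^-1 * \sum_x \sum_x' f v x * f v x' * p x x')))).
  by apply: ler_sum => v _; rewrite eA ler_wpM2l // -eT hN.
have -> : \sum_v PV v * (2^-1 * (c * (T + eta * n%:R)
    + c^-1 * \sum_x \sum_x' f v x * f v x' * p x x')) =
  2^-1 * (c * (T + eta * n%:R) +
    c^-1 * \sum_v PV v * \sum_x \sum_x' f v x * f v x' * p x x').
  rewrite -[X in _ = _ * (X + _)]mul1r -V1 mulr_suml mulr_sumr -big_split mulr_sumr.
  by apply: eq_bigr => v _ /=; ring.
rewrite ler_pM2l ?invr_gt0 ?ltr0n // lerD2l ler_pM2l ?invr_gt0 //.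
(* For each outcome [x'] the factor [f v x'] is the prediction made from it. It does not depend on
   [x] and has modulus at most 1, so only the bias given [x'] remains. *)
apply: (@le_trans _ _ (\sum_x' \sum_v PV v * `|\sum_x f v x * p x x'|)).
  rewrite exchange_big; apply: ler_sum => v _ /=; rewrite -mulr_sumr ler_wpM2l //.
  rewrite exchange_big; apply: ler_sum => x' _ /=.
  have -> : \sum_x f v x * f v x' * p x x' = f v x' * \sum_x f v x * p x x'.
    by rewrite mulr_sumr; apply: eq_bigr => x _; ring.
  by rewrite (le_trans (ler_norm _)) // normrM ler_piMl.
apply: (@le_trans _ _ (\sum_x' (2 * eps * (\sum_x p x x') + b^-1 * (mu * q x')))).
  apply: ler_sum => x' _; apply: (@bias_of_table _ _ _ f b mu (q x') eps (fun x => p x x')) => //.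
  exact: mulr_ge0.
rewrite big_split /= lerD //.
  rewrite -mulr_sumr exchange_big ler_wpM2l ?mulr_ge0 ?ler0n //= -eT.
  exact: ler_sum.
rewrite -!mulr_sumr ler_pM2l ?invr_gt0 // -[X in _ <= X]mulr1 ler_wpM2l //.
by rewrite -ts.
Qed.

(** Over all advice values the masses [T g0] add up to 1, while the term in [mu] is paid once per
    value; the assumption on [mu * #|K|%:R] keeps the latter total below [2 * eps]. *)
Lemma advice_bound (X V G : finType) n (r : X -> 'M[CC]_n) (sigma : 'M[CC]_n)
    (PV : V -> R) (f : V -> X -> R) (g : X -> G) (K : {set G}) (b mu eps : R) :
  (forall x, psdm (r x)) -> \sum_x cRe (\tr (r x)) = 1 ->
  psdm sigma -> cRe (\tr sigma) = 1 -> 0 <= mu ->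
  (forall x, psdm ((mu%:C)%C *: sigma - r x)) ->
  0 < b -> 0 < eps ->
  (forall v, 0 <= PV v) -> \sum_v PV v = 1 -> (forall v x, `|f v x| <= 1) ->
  (forall PX : X -> R, is_distr PX -> (forall x, PX x <= b) ->
     \sum_v PV v * `|\sum_x f v x * PX x| <= 2 * eps) ->
  (forall x, g x \in K) -> mu * #|K|%:R <= 2 * eps * b ->
  \sum_v PV v * \sum_(g0 in K) tn (\sum_(x | g x == g0) ((f v x)%:C)%C *: r x)
    <= 3 * Num.sqrt eps.
Proof.
move=> hr r1 hs ts mu0 hmu b0 e0 V0 V1 f1 hb gK hK.
set c := Num.sqrt eps; have c0 : 0 < c by rewrite sqrtr_gt0.
have cc2 : eps = c * c by rewrite -expr2 sqr_sqrtr // ltW.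
(* Small enough that the regularisation, summed over the advice values, adds at most 1 to the total
   mass; the successors avoid a division by zero. The sum is then at most half of
   [2 * c + 4 * c]. *)
pose eta : R := (#|K|.+1%:R * n.+1%:R)^-1.
have eta0 : 0 < eta by rewrite invr_gt0 mulr_gt0 ?ltr0n.
pose T g0 := \sum_(x | g x == g0) cRe (\tr (r x)).
under eq_bigr => v _ do rewrite mulr_sumr.
rewrite exchange_big /=.
apply: (@le_trans _ _ (\sum_(g0 in K)
   2^-1 * (c * (T g0 + eta * n%:R) + c^-1 * (2 * eps * T g0 + b^-1 * mu)))).
  apply: ler_sum => g0 _.
  by apply: (@advice_class_bound _ _ _ r sigma) => //; apply: ltW.
have T1 : \sum_(g0 in K) T g0 = 1.
  rewrite -r1 (partition_big g (mem K)) //=.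
rewrite -mulr_sumr big_split /= -!mulr_sumr !big_split /= -!mulr_sumr T1 !sumr_const.
have etaK : (eta * n%:R) *+ #|K| <= 1.
  rewrite -mulr_natr -mulrA ler_pdivrMl ?mulr_gt0 ?ltr0n // mulr1 mulrC -!natrM ler_nat.
  by rewrite leq_mul.
have muK : (b^-1 * mu) *+ #|K| <= 2 * eps.
  by rewrite -mulr_natr -mulrA ler_pdivrMl // [X in _ <= X]mulrC.
have ic : c^-1 * (2 * eps + 2 * eps) = 4 * c.
  by rewrite cc2; field; rewrite gt_eqF.
have h1 : c * (1 + (eta * n%:R) *+ #|K|) <= c * 2 by rewrite ler_pM2l //; lra.
have h2 : c^-1 * (2 * eps * 1 + (b^-1 * mu) *+ #|K|) <= 4 * c.
  by rewrite -ic ler_pM2l ?invr_gt0 //; lra.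
rewrite (mulrnAr eta) (mulrnAr b^-1); lra.
Qed.

(** * Advice for a weak design *)

Section Design.
Variables (n t d m : nat) (C : bits n -> bits t -> bool) (S : 'I_m -> {set 'I_d}).
Hypothesis St : forall i, #|S i| = t.

Definition ones (y : bits d) : {set 'I_d} := [set j | tnth y j].
Definition bits_of (A : {set 'I_d}) : bits d := [tuple j \in A | j < d].

(** Since [A] has exactly [t] elements, the default values in [restr] are never reached. *)
Lemma tnth_restr (y : bits d) (A : {set 'I_d}) (k : 'I_t) (hA : #|A| = t) :
  tnth (@restr d t y A) k = tnth y (enum_val (cast_ord (esym hA) k)).
Proof.
rewrite tnth_mktuple (tnth_nth false) /enum_val.
rewrite (nth_map (enum_val (cast_ord (esym hA) k))) -?cardE ?hA //.
by congr nth; congr val; apply: set_nth_default; rewrite -cardE hA.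
Qed.

Lemma restr_eq (y y' : bits d) (A : {set 'I_d}) : #|A| = t ->
  @restr d t y A = @restr d t y' A <-> {in A, tnth y =1 tnth y'}.
Proof.
move=> hA; split=> [e p pA|h].
  have := congr1 (fun u => tnth u (cast_ord hA (enum_rank_in pA p))) e.
  by rewrite !tnth_restr cast_ordK enum_rankK_in.
by apply: eq_from_tnth => k; rewrite !tnth_restr h // enum_valP.
Qed.

Variable i : 'I_m.

Definition outside (y : bits d) : {set 'I_d} := ones y :\: S i.

(** The second component is a possible set of ones of the seed among the positions that [S j] shares
    with [S i]. *)
Definition advice_index : pred ('I_m * {set 'I_d}) :=
  [pred ja : 'I_m * {set 'I_d} | (ja.1 < i)%N & ja.2 \subset S ja.1 :&: S i].

(* With the seed bits outside [S i] fixed to [w], the bit [C x y_(S j)] only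
   depends on the seed bits in [S j :&: S i]; the advice tabulates it. *)
Definition advice (w : {set 'I_d}) (x : bits n) : {ffun 'I_m * {set 'I_d} -> bool} :=
  [ffun ja => (ja \in advice_index) && C x (restr t (bits_of (w :|: ja.2)) (S ja.1))].

(** Only tables that are false off [advice_index] are counted, so that their number is governed by
    the number of indices and not by the size of the whole index type. *)
Definition advices : {set {ffun 'I_m * {set 'I_d} -> bool}} :=
  [set g in pffun_on false advice_index predT].

Lemma advice_in w x : advice w x \in advices.
Proof.
rewrite inE; apply/pffun_onP; split=> //; apply/supportP => ja hja.
by rewrite ffunE (negPf hja).
Qed.

Lemma advice_bit y x (j : 'I_m) : (j < i)%N ->
  advice (outside y) x (j, ones y :&: (S j :&: S i)) = C x (restr t y (S j)).
Proof.
move=> ji; rewrite ffunE inE /= ji subsetIr /=; congr (C x _).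
apply/restr_eq => // p pS; rewrite tnth_mktuple !inE pS /=.
by case: (p \in S i); case: (tnth y p).
Qed.

(** There is one free bit per index, and the exponent is exactly the sum that a weak design bounds
    by [r] times [m]. *)
Lemma card_advices : #|advices| = (2 ^ \sum_(j < m | (j < i)%N) 2 ^ #|S j :&: S i|)%N.
Proof.
rewrite cardsE card_pffun_on card_bool; congr (2 ^ _)%N.
rewrite -sum1_card.
rewrite -(pair_big_dep (fun j : 'I_m => (j < i)%N) (fun j (A : {set 'I_d}) => A \subset S j :&: S i)
   (fun _ _ => 1%N)) /=.
apply: eq_bigr => j _; rewrite sum1_card -card_powerset; apply: eq_card => A.
by rewrite powersetE.
Qed.

Lemma outside_restr_inj y y' :
  outside y = outside y' -> restr t y (S i) = restr t y' (S i) -> y = y'.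
Proof.
move=> /setP ho /(restr_eq _ _ (St i)) hr; apply: eq_from_tnth => p.
have := ho p; rewrite !inE; case: (boolP (p \in S i)) => [pS _|_] /=; last by [].
exact: hr.
Qed.

(** The earlier output bits, read off the table [g] at the entries selected by [y], form the prefix
    of [z]. *)
Definition consistent (y : bits d) (g : {ffun 'I_m * {set 'I_d} -> bool}) (z : bits m) :=
  [forall j : 'I_m, (j < i)%N ==> (g (j, ones y :&: (S j :&: S i)) == tnth z j)].

(** The table fixes the first [i] bits, so the remaining [m - i] bits determine the string. This
    count cancels the weight in [forall_minus_telescope]. *)
Lemma card_consistent y g : (#|[set z | consistent y g z]| <= 2 ^ (m - i))%N.
Proof.
pose suffix (z : bits m) : bits (m - i) := [tuple nth false z (i + j)%N | j < m - i].
rewrite -(card_in_imset (f := suffix)).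
  by apply: leq_trans (max_card _) _; rewrite card_tuple card_bool.
move=> z z'; rewrite !inE => /forallP hz /forallP hz' e.
apply: eq_from_tnth => j; have [ji|ij] := ltnP j i.
  by move: (hz j) (hz' j); rewrite ji /= => /eqP <- /eqP <-.
have hj : (j - i < m - i)%N by have := ltn_ord j; lia.
have := congr1 (fun u => tnth u (Ordinal hj)) e.
by rewrite !tnth_mktuple /= subnKC // -!tnth_nth.
Qed.

End Design.

(** * Hybrid argument over the output bits *)

Lemma forall_minus_telescope m (a : 'I_m -> bool) :
  [forall j, a j]%:R - 2%:R ^- m =
  \sum_(i < m) 2%:R ^- (m - i) *
     ([forall j : 'I_m, (j < i)%N ==> a j]%:R * (2 * (a i)%:R - 1)) :> R.
Proof.
(* The hybrid whose first [k] bits are those of the extractor and whose other bits are uniform. *)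
pose h (k : nat) : R := 2%:R ^- (m - k) * [forall j : 'I_m, (j < k)%N ==> a j]%:R.
have hm : [forall j, a j]%:R = h m.
  rewrite /h subnn expr0 invr1 mul1r; congr (nat_of_bool _)%:R.
  by apply: eq_forallb => j; rewrite ltn_ord.
have h0 : 2%:R ^- m = h 0%N.
  rewrite /h subn0; have -> : [forall j : 'I_m, (j < 0)%N ==> a j] by apply/forallP.
  by rewrite mulr1.
rewrite hm h0 -telescope_sumr // big_mkord; apply: eq_bigr => i _.
have e : [forall j : 'I_m, (j < i.+1)%N ==> a j] = [forall j : 'I_m, (j < i)%N ==> a j] && a i.
  apply/forallP/andP => [H|[/forallP H ai] j].
    split; last by have := H i; rewrite ltnSn.
    by apply/forallP => j; apply/implyP => ji; have := H j; rewrite ltnS ltnW.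
  apply/implyP; rewrite ltnS leq_eqVlt => /orP[/eqP /val_inj -> //|ji].
  by have := H j; rewrite ji.
rewrite /h e -mulnb natrM.
have -> : (m - i = (m - i.+1).+1)%N by rewrite subnSK.
by rewrite exprS invfM; field; rewrite expf_neq0 // pnatr_eq0.
Qed.

Lemma sgbM b c : sgb b * sgb c = 2 * (b == c)%:R - 1.
Proof. by rewrite /sgb; case: b; case: c; rewrite /= ?expr1 ?expr0; lra. Qed.

Lemma herm_sum N (X : finType) (P : pred X) (a : X -> R) (r : X -> 'M[CC]_N) :
  (forall x, (r x)^t* = r x) ->
  (\sum_(x | P x) ((a x)%:C)%C *: r x)^t* = \sum_(x | P x) ((a x)%:C)%C *: r x.
Proof.
move=> hr; rewrite [in LHS]raddf_sum raddf_sum; apply: eq_bigr => x _ /=.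
by rewrite adjmxZ hr; congr (_ *: _); apply: conjc_real.
Qed.

Section Seeds.
Variables (n t d m N : nat) (C : bits n -> bits t -> bool) (S : 'I_m -> {set 'I_d}).
Variable r : bits n -> 'M[CC]_N.
Hypothesis St : forall i, #|S i| = t.
Hypothesis hr : forall x, psdm (r x).

Definition class_diff (i : 'I_m) (y : bits d) (g : {ffun 'I_m * {set 'I_d} -> bool}) : 'M[CC]_N :=
  \sum_(x | advice C S i (outside S i y) x == g) ((sgb (C x (restr t y (S i))))%:C)%C *: r x.

(** The trace norm of the signed state when the advice is held in a further classical register: that
    state is block diagonal, with the [class_diff] as blocks. *)
Definition advice_norm i y : R := \sum_(g in advices S i) tn (class_diff i y g).

Let hermr x : (r x)^t* = r x. Proof. exact: psdm_herm. Qed.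

(** Whether [x] produces the prefix of [z] depends on [x] only through the advice, so the sum splits
    into whole advice classes. *)
Lemma prefix_diff_le (i : 'I_m) y (z : bits m) :
  tn (\sum_(x | [forall j : 'I_m, (j < i)%N ==> (C x (restr t y (S j)) == tnth z j)])
        ((sgb (C x (restr t y (S i))))%:C)%C *: r x) <=
  \sum_(g in advices S i | consistent S i y g z) tn (class_diff i y g).
Proof.
have agree x : [forall j : 'I_m, (j < i)%N ==> (C x (restr t y (S j)) == tnth z j)] =
    consistent S i y (advice C S i (outside S i y) x) z.
  apply: eq_forallb => j; case: (boolP (j < i)%N) => //= ji.
  by rewrite advice_bit.
rewrite (eq_bigl _ _ agree).
rewrite (partition_big (advice C S i (outside S i y))
  (fun g => (g \in advices S i) && consistent S i y g z)) /=; last first.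
  by move=> x ->; rewrite advice_in.
have -> : \sum_(g in advices S i | consistent S i y g z)
    \sum_(x | consistent S i y (advice C S i (outside S i y) x) z &&
              (advice C S i (outside S i y) x == g))
       ((sgb (C x (restr t y (S i))))%:C)%C *: r x =
  \sum_(g in advices S i | consistent S i y g z) (1%:C)%C *: class_diff i y g.
  apply: eq_bigr => g /andP[_ cg]; rewrite [RHS]scale1r; apply: eq_bigl => x.
  by apply: andb_idl => /eqP ->.
apply: le_trans (tn_sum _ _ _) _ => [g|]; first exact: herm_sum.
by apply: ler_sum => g _; rewrite normr1 mul1r.
Qed.

Lemma seed_bound y :
  \sum_z tn (\sum_x (((trevisan C S x y == z)%:R - 2%:R ^- m)%:C)%C *: r x) <=
  \sum_i advice_norm i y.
Proof.
pose pre (i : 'I_m) (z : bits m) := \sum_(x | [forall j : 'I_m, (j < i)%N ==> (C x (restr t y (S j)) == tnth z j)])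
        ((sgb (C x (restr t y (S i))))%:C)%C *: r x.
apply: (@le_trans _ _ (\sum_(z : bits m) \sum_(i < m) 2%:R ^- (m - i) *
   \sum_(g in advices S i | consistent S i y g z) tn (class_diff i y g))).
  apply: ler_sum => z _.
  have -> : \sum_x (((trevisan C S x y == z)%:R - 2%:R ^- m)%:C)%C *: r x =
     \sum_(i < m) ((2%:R ^- (m - i) * sgb (tnth z i))%:C)%C *: pre i z.
    under [RHS]eq_bigr => i _ do rewrite /pre big_mkcond scaler_sumr.
    rewrite exchange_big; apply: eq_bigr => x _ /=.
    have -> : (trevisan C S x y == z) = [forall j, C x (restr t y (S j)) == tnth z j].
      apply/eqP/forallP => [<- j|h]; first by rewrite tnth_mktuple.
      by apply: eq_from_tnth => j; rewrite tnth_mktuple; apply/eqP.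
    rewrite forall_minus_telescope real_complex_sum scaler_suml; apply: eq_bigr => i _.
    (* The sign of the [i]-th bit of [z] does not depend on [x], so it disappears in the norm; what
       is left depends on [z] only through its prefix. *)
    rewrite -sgbM; case: ifP => _; last by rewrite mul0r mulr0 scale0r scaler0.
    rewrite scalerA -real_complexM mul1r mulrA; congr ((_%:C)%C *: _); ring.
  apply: le_trans (tn_sum _ _ _) _ => [i|]; first exact: herm_sum.
  apply: ler_sum => i _; rewrite normrM norm_sgb mulr1 ger0_norm ?invr_ge0 ?exprn_ge0 ?ler0n //.
  by rewrite ler_wpM2l ?invr_ge0 ?exprn_ge0 ?ler0n // prefix_diff_le.
rewrite exchange_big; apply: ler_sum => i _ /=.
rewrite -mulr_sumr; under eq_bigr => z _ do rewrite big_mkcondr.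
(* For a fixed table [g], the norm is counted once for each consistent [z], hence at most
   [2 ^ (m - i)] times. *)
rewrite exchange_big mulr_sumr /=; apply: ler_sum => g _.
rewrite -big_mkcond /= sumr_const.
rewrite -[tn _ *+ _]mulr_natr ler_pdivrMl ?exprn_gt0 ?ltr0n // [X in X <= _]mulrC.
rewrite ler_wpM2r ?tn_ge0 // -natrX ler_nat.
by apply: leq_trans (card_consistent S i y g); rewrite cardsE.
Qed.

Lemma advice_norm_le i y : advice_norm i y <= \sum_x cRe (\tr (r x)).
Proof.
rewrite (partition_big (advice C S i (outside S i y)) (mem (advices S i))) /=; last first.
  by move=> x _; apply: advice_in.
apply: ler_sum => g _; apply: le_trans (tn_sum _ _ _) _ => //.
by apply: ler_sum => x _; rewrite norm_sgb mul1r; apply/Re_le/tnorm_psdm.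
Qed.

End Seeds.

(** * Averaging over the seed and choice of parameters *)

(** The seed is split into its part [w] outside [S i] and its part [v] inside. A fixing [w] of
    probability at most [theta] gets the trivial bound. For any other, conditioning raises the
    probabilities by a factor below [1 / theta], so [v] still has the min-entropy required by the
    one-bit extractor. *)
Lemma average_advice_norm n t d m N (C : bits n -> bits t -> bool) (S : 'I_m -> {set 'I_d})
    (r : bits n -> 'M[CC]_N) (sigma : 'M[CC]_N) (PY : bits d -> R) (i : 'I_m)
    (b bs bd mu eps : R) :
  (forall j, #|S j| = t) -> (forall x, psdm (r x)) -> \sum_x cRe (\tr (r x)) = 1 ->
  psdm sigma -> cRe (\tr sigma) = 1 -> 0 <= mu ->
  (forall x, psdm ((mu%:C)%C *: sigma - r x)) ->
  0 < b -> 0 < bs -> 0 < eps ->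
  (forall y, 0 <= PY y) -> \sum_y PY y = 1 -> (forall y, PY y <= bd) ->
  (forall PX PV, is_distr PX -> is_distr PV -> (forall x, PX x <= b) -> (forall v, PV v <= bs) ->
     \sum_v PV v * `|\sum_x sgb (C x v) * PX x| <= 2 * eps) ->
  mu * #|advices S i|%:R <= 2 * eps * b ->
  bd * 2 ^+ d = 3 * Num.sqrt eps * 2 ^+ t * bs ->
  \sum_y PY y * advice_norm C S r i y <= 6 * Num.sqrt eps.
Proof.
move=> St hr r1 hs ts mu0 hmu b0 bs0 e0 Y0 Y1 Yb hC hK hbd.
set delta := 3 * Num.sqrt eps in hbd *.
have delta0 : 0 < delta by rewrite mulr_gt0 ?ltr0n // sqrtr_gt0.
have two_gt0 k : 0 < (2 ^+ k : R) by rewrite exprn_gt0 // ltr0n.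
(* There are [2 ^ (d - t)] fixings, so those below this threshold weigh at most [delta] in total;
   also [bd / theta] is exactly [bs]. *)
pose theta := delta * 2 ^+ t / 2 ^+ d.
have theta0 : 0 < theta by rewrite divr_gt0 // mulr_gt0.
have bdE : bd = theta * bs.
  apply: (mulIf (lt0r_neq0 (two_gt0 d))); rewrite hbd /theta; field.
  exact: lt0r_neq0.
pose W := powerset (~: S i).
pose PW w := \sum_(y | outside S i y == w) PY y.
have PW0 w : 0 <= PW w by apply: sumr_ge0.
pose NN w v := \sum_(g in advices S i)
  tn (\sum_(x | advice C S i w x == g) ((sgb (C x v))%:C)%C *: r x).
have NNE y : advice_norm C S r i y = NN (outside S i y) (restr t y (S i)) by [].
have inW y : outside S i y \in W.
  by rewrite powersetE; apply/subsetP => p; rewrite !inE => /andP[].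
have WE : theta * #|W|%:R = delta.
  rewrite card_powerset natrX /theta.
  have -> : (2 ^+ d : R) = 2 ^+ t * 2 ^+ #|~: S i|.
    by rewrite -exprD -{1}(St i) cardsC card_ord.
  by field; rewrite !lt0r_neq0.
rewrite (partition_big (outside S i) (mem W)) //=.
(* A single bound covers both kinds of fixings; its two terms sum to [delta] each. *)
apply: (@le_trans _ _ (\sum_(w in W) (delta * PW w + theta))); last first.
  rewrite big_split /= -mulr_sumr sumr_const -[theta *+ _]mulr_natr WE.
  have -> : \sum_(w in W) PW w = 1 by rewrite -Y1 [RHS](partition_big (outside S i) (mem W)) //= => y _; apply: inW.
  by rewrite /delta; lra.
apply: ler_sum => w _; have [PWle|PWgt] := leP (PW w) theta.
  rewrite -[X in X <= _]add0r; apply: lerD; first by rewrite mulr_ge0 // ltW.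
  apply: le_trans PWle.
  apply: ler_sum => y _; rewrite ler_piMr // -r1.
  exact: advice_norm_le.
have PWpos : 0 < PW w by apply: lt_trans PWgt.
pose PV v := (\sum_(y | (outside S i y == w) && (restr t y (S i) == v)) PY y) / PW w.
have PV0 v : 0 <= PV v by rewrite divr_ge0 // sumr_ge0.
have PV1 : \sum_v PV v = 1.
  rewrite -mulr_suml -(partition_big (fun y => restr t y (S i)) xpredT) //= divff //.
  exact: lt0r_neq0.
have PVb v : PV v <= bs.
  rewrite ler_pdivrMr //.
  (* At most one seed has given parts outside and inside [S i], so the sum has at most one term. *)
  have [y /andP[/eqP ho /eqP hv]|none] := pickP [pred y | (outside S i y == w) && (restr t y (S i) == v)]; last first.
    by rewrite big_pred0 // mulr_ge0 // ltW.
  rewrite (big_pred1 y) => [|y'].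
    rewrite (le_trans (Yb y)) // bdE mulrC ler_wpM2l // ltW //.
  apply/andP/eqP => [[/eqP ho' /eqP hv']|->]; last by rewrite ho hv.
  by apply: (outside_restr_inj St (i := i)); rewrite ?ho ?hv.
have -> : \sum_(y | outside S i y == w) PY y * advice_norm C S r i y =
    PW w * \sum_v PV v * NN w v.
  rewrite (partition_big (fun y => restr t y (S i)) xpredT) //= mulr_sumr.
  apply: eq_bigr => v _; rewrite /PV mulrA [PW w * _]mulrC divfK ?lt0r_neq0 //.
  by rewrite mulr_suml; apply: eq_bigr => y /andP[/eqP <- /eqP <-]; rewrite NNE.
rewrite -[X in X <= _]addr0; apply: lerD; last exact: ltW.
rewrite [X in _ <= X]mulrC ler_wpM2l //.
apply: (@advice_bound _ _ _ _ r sigma PV (fun v x => sgb (C x v)) (advice C S i w) _ b mu) => //.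
- by move=> v x; rewrite norm_sgb.
- move=> PX hX hXb; apply: hC => //.
  by apply/is_distrP; split.
- by move=> x; apply: advice_in.
Qed.

Lemma Rpower2N x : Rpower 2 (- x) = (Rpower 2 x)^-1.
Proof. exact: Rpower_Ropp. Qed.

Lemma Rpower2_nat k : Rpower 2 (INR k) = 2 ^+ k.
Proof. by rewrite Rpower_pow ?RpowE2 //; Lra.lra. Qed.

Lemma trevisan_trnorm (n t d m : nat) (k s eps r : R) (C : bits n -> bits t -> bool)
    (S : 'I_m -> {set 'I_d}) (E : finType) (rho : mx (bits n * E)%type) (PY : bits d -> R) :
  0 < eps -> strong_ext (one_bit C) k eps s -> weak_design t r S ->
  density rho -> is_distr PY ->
  (k + r * INR m + log2 (1 / eps))%coqR <= Hmin_q rho ->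
  (INR d - (INR t - s - log2 (1 / (3 * sqrt eps))))%coqR <= Hmin_cl PY ->
  trnorm (msub (ext_state (trevisan C S) PY rho)
     (mtensor (mtensor (@rhoU m) (diagmx PY)) (ptrace1 rho))) <= 6 * Num.sqrt eps * m%:R.
Proof.
move=> e0 hC [St hS] hrho hY hk hs.
have [mu [sigma [mu0 mub psig tsig hmu]]] := Hmin_q_witness hrho hk.
have [Y0 Y1] := (is_distrP PY).1 hY.
have sq0 : 0 < Num.sqrt eps by rewrite sqrtr_gt0.
have hr x : psdm (toM (block rho x)) by apply/psdm_block/psdP; case: hrho.
have r1 : \sum_x cRe (\tr (toM (block rho x))) = 1.
  have <- : cRe (cc (mtr rho)) = 1 by case: hrho => _ ->.
  rewrite /mtr cc_sum Re_sum sum_pair; apply: eq_bigr => x _.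
  by rewrite -cc_mtr /mtr cc_sum Re_sum.
have e1 : Rpower 2 (- log2 (1 / eps)) = eps.
  rewrite Rpower2N Rpower2_log2 RdivE R1E ?mul1r ?invrK //.
  by rewrite invr_gt0.
have e3 : Rpower 2 (- log2 (1 / (3 * sqrt eps))) = 3 * Num.sqrt eps.
  have h3 : (3 * sqrt eps)%coqR = 3 * Num.sqrt eps :> R by rewrite RmultE RsqrtE IZRposE INRE.
  rewrite h3 Rpower2N Rpower2_log2 RdivE R1E ?mul1r ?invrK //.
  by rewrite invr_gt0 mulr_gt0 ?ltr0n.
have ts : cRe (\tr sigma) = 1 by rewrite tsig.
have hbias PX PV : is_distr PX -> is_distr PV ->
    (forall x, PX x <= Rpower 2 (- k)) -> (forall v, PV v <= Rpower 2 (- s)) ->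
    \sum_v PV v * `|\sum_x sgb (C x v) * PX x| <= 2 * eps.
  exact: strong_ext_bias hC.
(* In the entropy assumption, the term [r * INR m] pays for the number of tables and
   [log2 (1 / eps)] yields the factor [eps]; the 2 comes from [Hmin_q_witness]. *)
have hadv i : mu * #|advices S i|%:R <= 2 * eps * Rpower 2 (- k).
  have hcard : #|advices S i|%:R <= Rpower 2 (r * INR m).
    rewrite card_advices natrX -Rpower2_nat; apply: Rpower2_le.
    rewrite INRE natr_sum; move: (hS i) => /RleP; apply: le_trans.
    rewrite le_eqVlt; apply/orP; left; apply/eqP; apply: eq_bigr => j _.
    by rewrite RpowE2 natrX.
  apply: le_trans (ler_wpM2l mu0 hcard) _.
  apply: le_trans (ler_wpM2r (ltW (Rpower2_gt0 _)) mub) _.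
  rewrite !Ropp_plus_distr !Rpower2D e1 [Rpower 2 (- (r * INR m))]Rpower2N.
  have := Rpower2_gt0 (r * INR m); move: (Rpower 2 (r * INR m)) (Rpower 2 (- k)) => u v u0.
  by rewrite le_eqVlt; apply/orP; left; apply/eqP; field; rewrite lt0r_neq0.
(* The entropy demanded of the seed is the one for which the threshold on the fixings amounts to
   total weight [3 * Num.sqrt eps]. *)
have hbd : Rpower 2 (- (INR d - (INR t - s - log2 (1 / (3 * sqrt eps))))) * 2 ^+ d =
    3 * Num.sqrt eps * 2 ^+ t * Rpower 2 (- s).
  have -> : (- (INR d - (INR t - s - log2 (1 / (3 * sqrt eps)))))%coqR =
       (- INR d + (INR t + (- s + - log2 (1 / (3 * sqrt eps)))))%coqR by Lra.lra.
  rewrite !Rpower2D e3 Rpower2N !Rpower2_nat; field.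
  by rewrite expf_neq0 // pnatr_eq0.
have avg i : \sum_y PY y * advice_norm C S (fun x => toM (block rho x)) i y <= 6 * Num.sqrt eps.
  exact: (average_advice_norm St hr r1 psig ts mu0 hmu (Rpower2_gt0 _) (Rpower2_gt0 _) e0
    Y0 Y1 (fun y => Hmin_cl_ge y hY hs) hbias (hadv i) hbd).
apply: le_trans (trnorm_ext_state _ Y0 (fun x => psdm_herm (hr x))) _.
apply: (@le_trans _ _ (\sum_y PY y * \sum_i advice_norm C S (fun x => toM (block rho x)) i y)).
  by apply: ler_sum => y _; rewrite ler_wpM2l // seed_bound.
under eq_bigr => y _ do rewrite mulr_sumr.
rewrite exchange_big /=; apply: le_trans (ler_sum _ (fun i _ => avg i)) _.
by rewrite sumr_const card_ord mulr_natr.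
Qed.

Local Close Scope ring_scope.
Local Open Scope R_scope.

Theorem mainTheorem4 (n t d m : nat) (k s eps r : R)
    (C : bits n -> bits t -> bool) (S : 'I_m -> {set 'I_d}) :
  0 < eps ->
  strong_ext (one_bit C) k eps s ->
  weak_design t r S ->
  qproof_strong_ext (trevisan C S)
    (k + r * INR m + log2 (1 / eps))
    (6 * INR m * sqrt eps)
    (INR d - (INR t - s - log2 (1 / (3 * sqrt eps)))).
Proof.
move=> /RltP e0 hC hS E rho PY hrho _ hY /RleP hk /RleP hs.
have := trevisan_trnorm e0 hC hS hrho hY hk hs.
(* The bound obtained holds for the trace norm before halving; its nonnegativity carries it over to
   the halved norm. *)
have : (0 <= Num.sqrt eps * m%:R)%R by rewrite mulr_ge0 ?ler0n ?sqrtr_ge0.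
move=> h0 h1; apply/RleP; move: h0 h1; rewrite !RmultE RinvE RsqrtE INRE.
by move: (trnorm _) => T; rewrite !IZRposE !INRE /=; nra.
Qed.
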